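(* Let $\sigma\in(0,1)$, let $\Omega\subset\mathbb{R}^N$ be a bounded domain with $C^2$ boundary and let $f\in C(\bar\Omega)$. For $\epsilon\in(0,1)$ let $u_\epsilon$ be the solution to $$-\mathcal{I}_\epsilon[u]=f\ \text{ in }\Omega,\qquad u=0\ \text{ in }\Omega^c,$$ and let $u$ be the solution of $$C_{N,\sigma}(-\Delta)^\sigma u=f\ \text{ in }\Omega,\qquad u=0\ \text{ in }\Omega^c .$$ Then $u_\epsilon\to u$ in $L^\infty(\bar\Omega)$ as $\epsilon\to0$.
   Context: For $\epsilon\in(0,1)$, $$K_\epsilon(z)=\frac{1}{\epsilon^{N+2\sigma}+|z|^{N+2\sigma}},\qquad \mathcal{I}_\epsilon[u](x)=\int_{\mathbb{R}^N}[u(x+z)-u(x)]K_\epsilon(z)\,dz .$$ The solution $u_\epsilon$ is the unique bounded function on $\mathbb{R}^N$, continuous in $\Omega$, satisfying $-\mathcal{I}_\epsilon[u_\epsilon]=f$ pointwise in $\Omega$ and vanishing on $\Omega^c$ (equivalently, for the purpose of the $L^\infty$ norm, its version whose restriction to $\bar\Omega$ is continuous). The constant $C_{N,\sigma}>0$ is the normalizing constant for which $$-C_{N,\sigma}(-\Delta)^\sigma v(x)=\mathrm{P.V.}\int_{\mathbb{R}^N}[v(x+z)-v(x)]\,|z|^{-(N+2\sigma)}\,dz .$$ The solution $u$ of the fractional problem is its unique viscosity solution $u\in C(\bar\Omega)$, which satisfies $u=0$ on $\partial\Omega$ and, extended by $0$ to $\Omega^c$, is continuous on $\mathbb{R}^N$.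 *)

(* Defs.v *)
From HB Require Import structures.
From mathcomp Require Import all_boot all_order all_algebra.
From mathcomp Require Import all_classical all_reals all_analysis.

Set Implicit Arguments.
Unset Strict Implicit.
Unset Printing Implicit Defensive.
Import Order.TTheory GRing.Theory Num.Theory.
Import numFieldNormedType.Exports.
Local Open Scope classical_set_scope.
Local Open Scope ring_scope.

(* The sigma-algebra on 'rV[R]_n is generated by the coordinates; it is the
   Borel sigma-algebra of R^n. *)

Section measurable_rV.
Context {R : realType} (n : nat).

Let coord (i : 'I_n) (v : 'rV[R]_n) : R := v ord0 i.

Let rV_set0 : g_sigma_preimage coord set0.
Proof. exact: sigma_algebra0. Qed.

Let rV_setC A : g_sigma_preimage coord A -> g_sigma_preimage coord (~` A).
Proof. exact: sigma_algebraC. Qed.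

Let rV_bigcup (F : _^nat) : (forall i, g_sigma_preimage coord (F i)) ->
  g_sigma_preimage coord (\bigcup_i (F i)).
Proof. exact: sigma_algebra_bigcup. Qed.

HB.instance Definition _ :=
  @isMeasurable.Build (measure_tuple_display default_measure_display)
    'rV[R]_n (g_sigma_preimage coord) rV_set0 rV_setC rV_bigcup.

Lemma measurable_coord (i : 'I_n) :
  measurable_fun [set: 'rV[R]_n] (fun v : 'rV[R]_n => v ord0 i).
Proof.
move=> _ Y mY; rewrite setTI; apply: sub_sigma_algebra => /=.
rewrite -bigcup_seq/=; exists i => /=; first by rewrite mem_index_enum.
by exists Y => //; rewrite setTI.
Qed.

Lemma measurable_fun_rVP d (T : measurableType d) (f : T -> 'rV[R]_n) :
  (forall i, measurable_fun [set: T] (fun x => f x ord0 i)) ->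
  measurable_fun [set: T] f.
Proof.
move=> mf _ A mA; rewrite setTI.
pose G : set (set 'rV[R]_n) := [set B | measurable (f @^-1` B)].
suff: measurable `<=` G by exact.
apply: smallest_sub.
  split=> /=.
  - by rewrite /G /= preimage_set0.
  - move=> B mB; rewrite /G /= setTD preimage_setC.
    exact: measurableC.
  - move=> F mF; rewrite /G /= preimage_bigcup.
    exact: bigcupT_measurable.
move=> B; rewrite -bigcup_seq => -[i _ [Y mY <-]].
by have := mf i measurableT Y mY; rewrite /G /= !setTI.
Qed.
End measurable_rV.

(* Lebesgue measure on R^n, by induction on n: the image of the product of the
   one-dimensional and the n-dimensional measures under (x, v) |-> (x, v). *)

Section lebesgue_rV.
Context {R : realType}.

Definition consr n (p : measurableTypeR R * 'rV[R]_n) : 'rV[R]_n.+1 :=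
  row_mx (p.1 : R)%:M p.2 : 'rV[R]_(1 + n).

Lemma consr0 n (p : measurableTypeR R * 'rV[R]_n) : consr p ord0 ord0 = p.1.
Proof.
rewrite /consr (_ : ord0 = lshift n (ord0 : 'I_1)); last exact/val_inj.
by rewrite (@row_mxEl R 1 1 n) mxE eqxx mulr1n.
Qed.

Lemma consrS n (p : measurableTypeR R * 'rV[R]_n) (i : 'I_n) :
  consr p ord0 (lift ord0 i) = p.2 ord0 i.
Proof.
rewrite /consr (_ : lift ord0 i = rshift 1 i); last exact/val_inj.
by rewrite (@row_mxEr R 1 1 n).
Qed.

Definition unconsr n (v : 'rV[R]_n.+1) : measurableTypeR R * 'rV[R]_n :=
  (v ord0 ord0, \row_i v ord0 (lift ord0 i)).

Lemma consrK n : cancel (@consr n) (@unconsr n).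
Proof.
move=> [x v]; rewrite /unconsr consr0; congr pair.
by apply/rowP => i; rewrite mxE consrS.
Qed.

Lemma measurable_consr n : measurable_fun setT (@consr n).
Proof.
apply: measurable_fun_rVP => i; case: (unliftP ord0 i) => [j ->|->].
  under eq_fun do rewrite consrS.
  exact: (measurableT_comp (measurable_coord j) measurable_snd).
under eq_fun do rewrite consr0.
exact: measurable_fst.
Qed.

Lemma measurable_unconsr n : measurable_fun setT (@unconsr n).
Proof.
apply: measurable_fun_pair; first exact: measurable_coord.
apply: measurable_fun_rVP => i.
under eq_fun do rewrite mxE.
exact: measurable_coord.
Qed.

Section step.
Context n (mu : {sigma_finite_measure set 'rV[R]_n -> \bar R}).

Definition lebesgue_step : set 'rV[R]_n.+1 -> \bar R :=
  pushforward (lebesgue_measure \x mu)%E (@consr n).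

Let step : {measure set 'rV[R]_n.+1 -> \bar R} :=
  measure_function_pushforward__canonical__measure_function_Measure
    (lebesgue_measure \x mu)%E (@measurable_consr n).

Let step0 : lebesgue_step set0 = 0%E. Proof. exact: (measure0 step). Qed.

Let step_ge0 A : (0 <= lebesgue_step A)%E.
Proof. exact: (measure_ge0 step). Qed.

Let step_semi_sigma_additive : semi_sigma_additive lebesgue_step.
Proof. exact: (@measure_semi_sigma_additive _ _ _ step). Qed.

HB.instance Definition _ := isMeasure.Build _ _ _ lebesgue_step
  step0 step_ge0 step_semi_sigma_additive.

Let step_sigma_finite : sigma_finite setT lebesgue_step.
Proof.
have /sigma_finiteP[F [FT ndF Foo]] :=
  sigma_finiteT (@lebesgue_measure R : {sigma_finite_measure set _ -> \bar _}).
have /sigma_finiteP[G [GT ndG Goo]] := sigma_finiteT mu.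
exists (fun k => @unconsr n @^-1` (F k `*` G k)).
  apply/seteqP; split=> // v _.
  have : setT (v ord0 ord0 : measurableTypeR R) by [].
  rewrite FT => -[i _ Fi].
  have : setT (unconsr v).2 by [].
  rewrite GT => -[j _ Gj]; exists (maxn i j) => //; split.
    by move: Fi; exact/subsetPset/ndF/leq_maxl.
  by move: Gj; exact/subsetPset/ndG/leq_maxr.
move=> k; have [mF Fk] := Foo k; have [mG Gk] := Goo k; split.
  rewrite -[X in measurable X]setTI; apply: measurable_unconsr => //.
  exact: measurableX.
rewrite /lebesgue_step /pushforward -comp_preimage.
rewrite (_ : _ \o _ = id); last by apply/funext => p /=; rewrite consrK.
by rewrite preimage_id product_measure1E// lte_mul_pinfty// ge0_fin_numE.
Qed.

HB.instance Definition _ := Measure_isSigmaFinite.Build _ _ _ lebesgue_step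
  step_sigma_finite.

End step.

Fixpoint lebesgue_rV n : {sigma_finite_measure set 'rV[R]_n -> \bar R} :=
  if n is n'.+1 then lebesgue_step (lebesgue_rV n') else \d_ (0 : 'rV[R]_0).

Lemma lebesgue_rV_box n (a b : 'I_n -> R) :
  lebesgue_rV n [set v : 'rV[R]_n | forall i, a i < v ord0 i <= b i] =
  (\prod_(i < n) Num.max (b i - a i) 0)%:E.
Proof.
elim: n a b => [|n IHn] a b.
  by rewrite big_ord0 /= diracE mem_set//= => -[].
have Ebox : @consr n @^-1` [set v : 'rV[R]_n.+1 | forall i, a i < v ord0 i <= b i] =
    ([set` `]a ord0, b ord0]%R] : set (measurableTypeR R)) `*`
    [set v : 'rV[R]_n |
      forall i : 'I_n, a (lift ord0 i) < v ord0 i <= b (lift ord0 i)].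
  apply/seteqP; split => [p /= bp|p /= [p1 p2] i].
    split; first by have := bp ord0; rewrite consr0 in_itv.
    by move=> i; have := bp (lift ord0 i); rewrite consrS.
  case: (unliftP ord0 i) => [j ->|->]; first by rewrite consrS.
  by move: p1; rewrite consr0 in_itv.
rewrite /= /lebesgue_step /pushforward Ebox product_measure1E//; last first.
  rewrite (_ : mkset _ = \bigcap_(i in [set: 'I_n])
     ((fun v : 'rV[R]_n => v ord0 i) @^-1`
       [set` `]a (lift ord0 i), b (lift ord0 i)]%R])).
    apply: fin_bigcap_measurable => // i _; rewrite -[X in measurable X]setTI.
    exact: measurable_coord.
  by apply/seteqP; split=> v /= vab i; have := vab i; rewrite /= in_itv //; apply.
rewrite big_ord_recl EFinM.
rewrite IHn; congr (_ * _)%E.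
apply: etrans (lebesgue_measure_itv `]a ord0, b ord0]%R) _; rewrite /= lte_fin.
case: ltP => ab; first by rewrite max_l// subr_ge0 ltW.
by rewrite max_r// subr_le0.
Qed.
End lebesgue_rV.

Section euclidean.
Context {R : realType} {n : nat}.
Implicit Types (x z : 'rV[R]_n) (g : 'rV[R]_n -> R).

(* The library norm on matrices is the sup norm. *)
Definition enorm z : R := Num.sqrt (\sum_(i < n) z ord0 i ^+ 2).

Definition eball x (r : R) : set 'rV[R]_n := [set y | enorm (y - x) < r].

Definition partial (i : 'I_n) g : 'rV[R]_n -> R := 'D_(delta_mx ord0 i) g.

Definition C1 g := continuous g /\
  forall i : 'I_n, (forall x, derivable g x (delta_mx ord0 i)) /\
    continuous (partial i g).

Definition C2 g := C1 g /\ forall i : 'I_n, C1 (partial i g).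

End euclidean.

Section domain.
Context {R : realType} {n : nat}.
Implicit Types Om : set 'rV[R]_n.+1.

(* After relabelling and reorienting the axes, Om is near each boundary point
   the strict epigraph of a C2 function of the other n coordinates; the bit b
   is the orientation of the i-th axis. *)
Definition C2_boundary Om := forall x0, (closure Om `\` interior Om) x0 ->
  exists (i : 'I_n.+1) (b : bool) (g : 'rV[R]_n -> R), C2 g /\
    \forall x \near x0, Om x <-> g (col' i x) < (-1) ^+ b * x ord0 i.

Definition bounded_C2_domain Om :=
  [/\ open Om, connected Om, Om !=set0, bounded_set Om & C2_boundary Om].

End domain.

Section operators.
Context {R : realType} {n : nat}.
Variable sigma : R.
Implicit Types (x z : 'rV[R]_n.+1) (u v : 'rV[R]_n.+1 -> R).

Local Notation N := (n.+1%:R : R).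
Local Notation mu := (lebesgue_rV n.+1).

Definition kernel_eps (eps : R) z : R :=
  (eps `^ (N + 2 * sigma) + enorm z `^ (N + 2 * sigma))^-1.

Definition nonlocal_eps (eps : R) u x : R :=
  \int[mu]_z ((u (x + z) - u x) * kernel_eps eps z).

Definition pv_integral v x : R :=
  lim ((\int[mu]_(z in [set z | (r <= enorm z)%R])
          ((v (x + z) - v x) / enorm z `^ (N + 2 * sigma))) @[r --> 0^'+]).

(* With (-Delta)^sigma the operator of Fourier symbol |xi|^(2 sigma), the
   principal value integral has symbol - C |xi|^(2 sigma) for this C. *)
Definition norm_const : R :=
  \int[mu]_z ((1 - cos (z ord0 ord0)) / enorm z `^ (N + 2 * sigma)).

Definition fractional_laplacian v x : R := - norm_const^-1 * pv_integral v x.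

End operators.
Arguments norm_const {R} n sigma.

Section solutions.
Context {R : realType} {n : nat}.
Variables (sigma : R) (Om : set 'rV[R]_n.+1) (f : 'rV[R]_n.+1 -> R).
Implicit Types (u phi : 'rV[R]_n.+1 -> R).

Definition approx_solution (eps : R) u :=
  [/\ [bounded u x | x in setT],
      forall x, Om x -> {for x, continuous u},
      forall x, Om x -> - nonlocal_eps sigma eps u x = f x &
      forall x, ~ Om x -> u x = 0].

(* patch u (eball x0 r) phi is phi on the ball and u outside: the test function
   is only used near x0. *)
Definition visc_subsolution u :=
  forall x0 (r : R) phi, 0 < r -> eball x0 r `<=` Om ->
    C2 phi -> phi x0 = u x0 -> (forall y, eball x0 r y -> u y <= phi y) ->
    norm_const n sigma * fractional_laplacian sigma (patch u (eball x0 r) phi) x0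
      <= f x0.

Definition visc_supersolution u :=
  forall x0 (r : R) phi, 0 < r -> eball x0 r `<=` Om ->
    C2 phi -> phi x0 = u x0 -> (forall y, eball x0 r y -> phi y <= u y) ->
    f x0 <=
    norm_const n sigma * fractional_laplacian sigma (patch u (eball x0 r) phi) x0.

Definition visc_solution u :=
  [/\ {within closure Om, continuous u}, visc_subsolution u,
      visc_supersolution u & forall x, ~ Om x -> u x = 0].

End solutions.

Definition Linfty_norm {R : realType} {n : nat} (A : set 'rV[R]_n)
    (g : 'rV[R]_n -> R) : \bar R :=
  ('N[lebesgue_rV n]_+oo[EFin \o (g \_ A)])%E.

(* Main.v *)
(* The comparison is by doubling the variables, without half-relaxed limits.
   Suppose that u - u_eps exceeds m somewhere, and maximize
   u(x) - u_eps(y) - a|x-y|^2, exactly in x and up to a small kappa in y; this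
   gives points x0, y0 with |x0-y0| small.  Comparing the value at (x0,y0) with
   those at (x0+z,y0+z), (x0+z,y0) and (x0,y0+z) bounds the increments of u at
   x0 by those of u_eps at y0, and bounds the former above and the latter below
   by paraboloids with the same linear part, which the even kernels ignore.

   If x0 and y0 are both in the domain, the paraboloid at x0 is an admissible
   test function.  Subtracting the two equations leaves f(x0) - f(y0) and small
   errors (the paraboloids near 0, and K_eps against |z|^-(N+2 sigma) away from
   0), against the gain at the z so large that both functions vanish.

   If y0 is outside, u(x0) is small because u is continuous and vanishes there.

   If x0 is outside, -u_eps nearly attains at y0 its maximum over a strip around
   the boundary, since u is small on it.  Near y0 the complement of the domain
   contains a cube of size comparable to s, the bound on |x0-y0|: this is where
   the regularity of the boundary is used.  Perturbing -u_eps at scale s by a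
   paraboloid, the gain on that cube is of order m s^(-2 sigma), while the
   losses are eta s^(-2 sigma) with eta as small as desired, or O(1). *)
Require Import Defs.
From mathcomp Require Import all_boot all_order all_algebra.
From mathcomp Require Import all_classical all_reals all_analysis.
From mathcomp Require Import measurable_realfun ess_sup_inf.
From mathcomp Require Import ring lra.
Import Order.TTheory GRing.Theory Num.Theory.
Import numFieldNormedType.Exports.
Local Open Scope classical_set_scope.
Local Open Scope ring_scope.
Set Implicit Arguments.
Unset Strict Implicit.
Unset Printing Implicit Defensive.

(** * Euclidean geometry and Borel measurability *)

Section euclidean_geometry.
Context {R : realType} {n : nat}.
Implicit Types (a b c x y z : 'rV[R]_n) (r : R).

Definition nsq z : R := \sum_(i < n) z ord0 i ^+ 2.

Definition dotr a z : R := \sum_(i < n) a ord0 i * z ord0 i.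

Lemma nsq_ge0 z : 0 <= nsq z.
Proof. by apply: sumr_ge0 => i _; exact: sqr_ge0. Qed.

Lemma enorm_ge0 z : 0 <= enorm z. Proof. exact: sqrtr_ge0. Qed.

Lemma sqr_enorm z : enorm z ^+ 2 = nsq z.
Proof. by rewrite sqr_sqrtr// nsq_ge0. Qed.

Lemma nsqD a b : nsq (a + b) = nsq a + 2 * dotr a b + nsq b.
Proof.
rewrite /nsq /dotr mulr_sumr -!big_split/=; apply: eq_bigr => i _.
by rewrite mxE; ring.
Qed.

Lemma nsqN z : nsq (- z) = nsq z.
Proof. by apply: eq_bigr => i _; rewrite mxE sqrrN. Qed.

Lemma dotrN c z : dotr c (- z) = - dotr c z.
Proof. by rewrite /dotr -sumrN; apply: eq_bigr => i _; rewrite mxE mulrN. Qed.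

Lemma enormN z : enorm (- z) = enorm z.
Proof. by congr Num.sqrt; exact: nsqN. Qed.

Lemma enormB a b : enorm (a - b) = enorm (b - a).
Proof. by rewrite -enormN opprB. Qed.

Lemma nsqD_le a b : nsq (a + b) <= 2 * (nsq a + nsq b).
Proof.
rewrite /nsq -big_split/= mulr_sumr; apply: ler_sum => i _; rewrite mxE.
by have := sqr_ge0 (a ord0 i - b ord0 i); nra.
Qed.

Lemma enorm_leE r z : 0 <= r -> (enorm z <= r) = (nsq z <= r ^+ 2).
Proof.
by move=> r0; rewrite -sqr_enorm ler_sqr ?nnegrE// enorm_ge0.
Qed.

(** A substitute for the triangle inequality of [enorm], read off from |a+b|^2 <= 2(|a|^2+|b|^2);
    the lost constant is harmless later. *)
Lemma enormD_le r a b : enorm a <= r -> enorm b <= r -> enorm (a + b) <= 2 * r.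
Proof.
move=> ar br; have r0 : 0 <= r := le_trans (enorm_ge0 _) ar.
rewrite enorm_leE ?mulr_ge0//; move: ar br; rewrite !enorm_leE// => ar br.
by have := nsqD_le a b; nra.
Qed.

Lemma coord_le_enorm z i : `|z ord0 i| <= enorm z.
Proof.
rewrite -ler_sqr ?nnegrE ?enorm_ge0// sqr_enorm real_normK ?num_real//.
by rewrite /nsq (bigD1 i)//= lerDl sumr_ge0// => j _; exact: sqr_ge0.
Qed.

Lemma norm_le_enorm z : `|z| <= enorm z.
Proof.
rewrite [leLHS]/Num.norm/= mx_normrE; apply/bigmax_leP; split.
  exact: enorm_ge0.
by move=> [i j] _ /=; rewrite ord1; exact: coord_le_enorm.
Qed.

Lemma coord_le_norm z i : `|z ord0 i| <= `|z|.
Proof.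
rewrite [leRHS]/Num.norm/= mx_normrE.
by apply: (le_bigmax _ (fun ij : 'I_1 * 'I_n => `|z ij.1 ij.2|) (ord0, i)).
Qed.

Lemma enorm_le_coord r z : 0 <= r -> (forall i, `|z ord0 i| <= r) ->
  enorm z <= n%:R * r.
Proof.
move=> r0 zr; rewrite enorm_leE ?mulr_ge0//.
apply: (@le_trans _ _ (\sum_(i < n) r ^+ 2)).
  apply: ler_sum => i _; rewrite -(real_normK (num_real (z ord0 i))).
  by rewrite ler_sqr ?nnegrE.
rewrite sumr_const card_ord -[r ^+ 2 *+ n]mulr_natl exprMn ler_wpM2r ?sqr_ge0//.
by rewrite -natrX ler_nat; case: (n) => // k; rewrite -mulnn leq_pmulr.
Qed.

Lemma enorm_le_norm z : enorm z <= n%:R * `|z|.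
Proof. by apply: enorm_le_coord => // i; exact: coord_le_norm. Qed.

End euclidean_geometry.

Section borel_rV.
Context {R : realType}.

Lemma measurable_ball_rV n (x : 'rV[R]_n) (r : R) : measurable (ball x r).
Proof.
have [r0|r0] := ltP 0 r; last first.
  rewrite (_ : ball x r = set0)//; apply/seteqP; split => // y.
  by case; rewrite ltNge r0.
rewrite (_ : ball x r = \bigcap_(i in [set: 'I_n])
    ((fun v : 'rV[R]_n => v ord0 i) @^-1` ball (x ord0 i) r)).
  apply: fin_bigcap_measurable => // i _; rewrite -[X in measurable X]setTI.
  apply: measurable_coord => //; exact: measurable_realfun.measurable_ball.
apply/seteqP; split => [y [_ xy] i _|y xy]; first exact: xy.
by split => // i j; rewrite ord1; exact: xy.
Qed.

(** Sup-norm balls are measurable for the coordinates, and an open set is the union of the balls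
    with rational centre and radius 1/(k+1) that it contains. [F] enumerates them, with empty terms
    for all other codes. *)
Lemma open_measurable_rV n (A : set 'rV[R]_n) : open A -> measurable A.
Proof.
move=> oA.
pose B (qk : 'rV[rat]_n * nat) : set 'rV[R]_n :=
  ball (map_mx ratr qk.1 : 'rV[R]_n) qk.2.+1%:R^-1.
pose F m : set 'rV[R]_n := if unpickle m is Some qk then
  (if `[< B qk `<=` A >] then B qk else set0) else set0.
rewrite (_ : A = \bigcup_m F m).
  apply: bigcupT_measurable => m; rewrite /F; case: unpickle => // qk.
  by case: asboolP => // _; exact: measurable_ball_rV.
apply/seteqP; split=> [x Ax|x [m _]]; last first.
  by rewrite /F; case: unpickle => // qk; case: asboolP => // + Bx; apply.
have /nbhs_ballP[e /= e0 eA] : nbhs x A by exact: open_nbhs_nbhs.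
have [k _ ke] : exists2 k, True & k.+1%:R^-1 < e / 2.
  have [k] := near_infty_natSinv_lt (PosNum (divr_gt0 e0 (ltr0n R 2))).
  by move=> _ /(_ k (leqnn k)) /= H; exists k.
have /choice[q qx] : forall i, exists q : rat,
    ratr q \in `](x ord0 i - k.+1%:R^-1), (x ord0 i + k.+1%:R^-1)[.
  move=> i; apply: rat_in_itvoo; rewrite ltrD2l.
  by rewrite gtrN// invr_gt0.
have xB : B (\row_i q i, k) x.
  split => [|i j]; first by rewrite invr_gt0.
  rewrite !mxE /ball_ /= ord1; have := qx j; rewrite in_itv/= => /andP[? ?].
  by rewrite /ball/= ltr_distl; apply/andP.
exists (pickle (\row_i q i, k)) => //; rewrite /F pickleK.
case: asboolP => // -[] y yB; apply: eA => /=.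
apply: (@ball_splitr _ _ (map_mx ratr (\row_i q i) : 'rV[R]_n)).
  exact: (le_ball (ltW ke) xB).
exact: (le_ball (ltW ke) yB).
Qed.

Lemma measurable_fun_gtP d (T : measurableType d) (f : T -> R) :
  (forall a, measurable [set x | a < f x]) -> measurable_fun setT f.
Proof.
move=> mf; apply: (measurability _ (RGenOInfty.measurableE R)).
move=> _ [_ [a ->] <-]; rewrite setTI; have := mf a.
by congr measurable; apply/seteqP; split => x /=; rewrite in_itv/= andbT.
Qed.

Lemma continuous_measurable_fun_rV n (g : 'rV[R]_n -> R) :
  continuous g -> measurable_fun setT g.
Proof.
move=> cg; apply: measurable_fun_gtP => a; apply: open_measurable_rV.
have -> : [set x | a < g x] = g @^-1` [set y | a < y] by [].
by apply: open_comp => [x _|]; [exact: cg|exact: open_gt].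
Qed.

(** Made for the approximate solutions, which may jump across the boundary. A superlevel set is an
    open part of [Om] together with all or none of the complement. *)
Lemma measurable_fun_open_support n (Om : set 'rV[R]_n) (g : 'rV[R]_n -> R) :
  open Om -> (forall x, Om x -> {for x, continuous g}) ->
  (forall x, ~ Om x -> g x = 0) -> measurable_fun setT g.
Proof.
move=> oOm cg g0; apply: measurable_fun_gtP => a.
have -> : [set x | a < g x] =
    (Om `&` [set x | a < g x]) `|` (~` Om `&` [set x | a < 0]).
  apply/seteqP; split => x /= [].
    by have [Omx|Omx] := pselect (Om x); [left|right; rewrite -(g0 x)].
  - by case.
  - by case=> /g0 ->.
apply: measurableU.
  apply: open_measurable_rV; rewrite openE => x [Omx ax].
  apply: filterI; first exact: open_nbhs_nbhs.
  apply: (cg x Omx [set y | a < y]).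
  by apply: open_nbhs_nbhs; split.
apply: measurableI; first by apply: measurableC; exact: open_measurable_rV.
have [a0|a0] := boolP (a < 0).
  by rewrite (_ : [set _ | _] = setT)//; apply/seteqP; split.
by rewrite (_ : [set _ | _] = set0)//; apply/seteqP; split => // x /=.
Qed.

Lemma measurable_nsq n : measurable_fun setT (@nsq R n).
Proof.
rewrite (_ : @nsq R n = fun z => \sum_(i < n) z ord0 i ^+ 2)//.
apply: measurable_sum => i; apply: measurable_funX; exact: measurable_coord.
Qed.

Lemma measurable_dotr n (c : 'rV[R]_n) : measurable_fun setT (dotr c).
Proof.
rewrite (_ : dotr c = fun z => \sum_(i < n) c ord0 i * z ord0 i)//.
apply: measurable_sum => i; apply: measurable_funM => //.
exact: measurable_coord.
Qed.

Lemma measurable_enorm n : measurable_fun setT (@enorm R n).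
Proof.
apply: (measurableT_comp _ (@measurable_nsq n)).
apply: continuous_measurable_fun => x; exact: sqrt_continuous.
Qed.

Lemma measurable_addl_rV n (x : 'rV[R]_n) :
  measurable_fun setT (fun z : 'rV[R]_n => x + z).
Proof.
apply: measurable_fun_rVP => i.
rewrite (_ : (fun _ => _) = fun z : 'rV[R]_n => x ord0 i + z ord0 i); last first.
  by apply/funext => z; rewrite mxE.
by apply: measurable_funD => //; exact: measurable_coord.
Qed.

Lemma measurable_opp_rV n : measurable_fun setT (fun z : 'rV[R]_n => - z).
Proof.
apply: measurable_fun_rVP => i.
rewrite (_ : (fun _ => _) = fun z : 'rV[R]_n => - z ord0 i); last first.
  by apply/funext => z; rewrite mxE.
by apply: measurable_funN; exact: measurable_coord.
Qed.

Lemma measurable_box n (a b : 'I_n -> R) :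
  measurable [set v : 'rV[R]_n | forall i, a i < v ord0 i <= b i].
Proof.
rewrite (_ : mkset _ = \bigcap_(i in [set: 'I_n])
   ((fun v : 'rV[R]_n => v ord0 i) @^-1` [set` `]a i, b i]%R])).
  apply: fin_bigcap_measurable => // i _; rewrite -[X in measurable X]setTI.
  exact: measurable_coord.
by apply/seteqP; split=> v /= vab i; have := vab i; rewrite /= in_itv //; apply.
Qed.

Lemma measurable_enorm_lt n (r : R) :
  measurable [set z : 'rV[R]_n | enorm z < r].
Proof.
rewrite -[X in measurable X]setTI.
rewrite (_ : [set z | _] = @enorm R n @^-1` `]-oo, r[%classic); last first.
  by apply/seteqP; split => z /=; rewrite in_itv.
exact: measurable_enorm.
Qed.

End borel_rV.

(** * Reflection invariance of the Lebesgue measure *)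

Section reflection.
Context {R : realType}.

Lemma consrN n (p : measurableTypeR R * 'rV[R]_n) :
  consr (- p.1 : R, - p.2) = - consr p.
Proof.
apply/rowP => i; rewrite [RHS]mxE -[0]/(ord0 : 'I_1).
case: (unliftP ord0 i) => [j ->|->].
  by rewrite !consrS mxE.
by rewrite !consr0.
Qed.

(** By induction on the dimension: the image of the product measure under negation agrees with it on
    rectangles, and these determine a product measure. *)
Lemma lebesgue_rV_opp n (A : set 'rV[R]_n) : measurable A ->
  lebesgue_rV n (-%R @^-1` A) = lebesgue_rV n A.
Proof.
elim: n A => [|n IH] A mA.
  congr (lebesgue_rV 0 _); apply/seteqP; split => x /=;
  by rewrite (_ : - x = x)//; apply/rowP => -[].
pose mu : {measure set (measurableTypeR R * 'rV[R]_n) -> \bar R} :=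
  (@lebesgue_measure R \x lebesgue_rV n)%E.
pose opp2 (p : measurableTypeR R * 'rV[R]_n) : measurableTypeR R * 'rV[R]_n :=
  (- p.1 : R, - p.2).
have mopp2 : measurable_fun setT opp2.
  apply: measurable_fun_pair.
    by apply: measurable_funN; exact: measurable_fst.
  by apply: (measurableT_comp (@measurable_opp_rV R n)); exact: measurable_snd.
pose m : {measure set (measurableTypeR R * 'rV[R]_n) -> \bar R} :=
  measure_function_pushforward__canonical__measure_function_Measure mu mopp2.
have mcA : measurable (@consr R n @^-1` A).
  by rewrite -[X in measurable X]setTI; exact: measurable_consr.
rewrite /= /lebesgue_step /pushforward -[RHS]/(mu _).
transitivity (m (@consr R n @^-1` A)).
  rewrite /m/= /pushforward -/mu; congr (mu _).
  by apply/seteqP; split => p /=; rewrite consrN.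
apply/esym/(product_measure_unique _ mcA) => X Y mX mY.
rewrite /m/= /pushforward (_ : _ @^-1` _ = (-%R @^-1` X) `*` (-%R @^-1` Y))//.
rewrite /mu /= product_measure1E ?IH//.
- by congr (_ * _)%E; exact: lebesgue_measureN.
- by rewrite -[X in measurable X]setTI; exact: oppr_measurable.
- by rewrite -[X in measurable X]setTI; exact: measurable_opp_rV.
Qed.

Local Notation mu n := (lebesgue_rV n : {measure set 'rV[R]_n -> \bar R}).

Lemma Rintegral_odd n (h : 'rV[R]_n -> R) :
  (mu n).-integrable setT (EFin \o h) -> (forall z, h (- z) = - h z) ->
  \int[mu n]_z h z = 0.
Proof.
move=> ih hodd; set I := \int[mu n]_z h z.
have mN := @measurable_opp_rV R n.
have hN : h \o -%R = \- h by apply/funext => z /=; rewrite hodd.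
have mh : measurable_fun setT h by case/integrableP : ih => /measurable_EFinP.
suff : I = - I by move=> /eqP; rewrite -subr_eq0 opprK -mulr2n mulrn_eq0/= => /eqP.
rewrite {1}/I /Rintegral.
pose m : {measure set 'rV[R]_n -> \bar R} :=
  measure_function_pushforward__canonical__measure_function_Measure (mu n) mN.
rewrite (eq_measure_integral m); last first.
  by move=> A mA _; apply/esym; exact: lebesgue_rV_opp.
rewrite integral_pushforward//=; last 2 first.
- exact/measurable_EFinP.
- rewrite preimage_setT (_ : _ \o _ = EFin \o (\- h)); last first.
    by apply/funext => z /=; rewrite hodd.
  exact: integrableN ih.
rewrite preimage_setT (eq_integral (fun z => (- 1%:E) * (h z)%:E)%E); last first.
  by move=> z _ /=; rewrite hodd EFinN mulN1e.
rewrite integralZl//= mulN1e.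
by rewrite /I /Rintegral fineN.
Qed.

End reflection.

(** * Integral bounds from dyadic shells *)

Section lebesgue_rV_bounds.
Context {R : realType} {n : nat}.
Local Notation mu := (lebesgue_rV n : {measure set 'rV[R]_n -> \bar R}).

Lemma measurable_enorm_le (r : R) : measurable [set z : 'rV[R]_n | enorm z <= r].
Proof.
rewrite -[X in measurable X]setTI.
rewrite (_ : [set z | _] = @enorm R n @^-1` `]-oo, r]%classic); last first.
  by apply/seteqP; split => z /=; rewrite in_itv.
exact: measurable_enorm.
Qed.

Lemma lebesgue_rV_enorm_le (r : R) : 0 < r ->
  (mu [set z | (enorm z <= r)%R] <= ((4 * r) ^+ n)%:E)%E.
Proof.
(* Half-side [2 * r] rather than [r]: the boxes omit their left faces, which the ball of radius [r]
   may touch. *)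
move=> r0; pose a (i : 'I_n) : R := - (2 * r); pose b (i : 'I_n) := 2 * r.
rewrite (_ : _ ^+ n = \prod_(i < n) Num.max (b i - a i) 0); last first.
  rewrite (eq_bigr (fun=> 4 * r)) ?prodr_const ?card_ord// => i _.
  by rewrite /b /a max_l; lra.
rewrite -lebesgue_rV_box; apply: le_measure; rewrite ?inE.
- exact: measurable_enorm_le.
- exact: measurable_box.
move=> z /= zr i; have := le_trans (coord_le_enorm z i) zr.
by rewrite ler_norml /a /b => /andP[? ?]; apply/andP; split; lra.
Qed.

Lemma le_integrable_fin (h g : 'rV[R]_n -> R) : measurable_fun setT h ->
  (forall z, `|h z| <= g z) -> mu.-integrable setT (EFin \o g) ->
  mu.-integrable setT (EFin \o h).
Proof.
move=> mh hg; apply: le_integrable => //; first exact/measurable_EFinP.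
move=> z _ /=; rewrite lee_fin (le_trans (hg z))// ler_norm//.
Qed.

Lemma ge0_integrable_bound (h : 'rV[R]_n -> R) (c : R) :
  measurable_fun setT h -> (forall z, 0 <= h z) ->
  (\int[mu]_z (h z)%:E <= c%:E)%E ->
  mu.-integrable setT (EFin \o h) /\ \int[mu]_z h z <= c.
Proof.
move=> mh h0 hc.
have ih : mu.-integrable setT (EFin \o h).
  apply/integrableP; split; first exact/measurable_EFinP.
  rewrite (eq_integral (EFin \o h)); last first.
    by move=> z _ /=; rewrite ger0_norm.
  by rewrite (le_lt_trans hc)// ltry.
split=> //; rewrite -lee_fin /Rintegral fineK//.
exact: (integrable_fin_num _ ih).
Qed.

(** [h] lies below the sum of the functions equal to [ht k] on the ball of radius [rt k] and to 0
    elsewhere. The volume bound makes the k-th integral at most c q^k, and the geometric series is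
    summed. *)
Lemma dyadic_integral_bound (h : 'rV[R]_n -> R) (ht rt : nat -> R) (c q : R) :
  measurable_fun setT h -> (forall z, 0 <= h z) ->
  (forall k, 0 < rt k) -> (forall k, 0 <= ht k) ->
  (forall z, 0 < h z -> exists k, enorm z <= rt k /\ h z <= ht k) ->
  0 <= q < 1 -> 0 <= c -> (forall k, ht k * (4 * rt k) ^+ n <= c * q ^+ k) ->
  mu.-integrable setT (EFin \o h) /\ \int[mu]_z h z <= c / (1 - q).
Proof.
move=> mh h0 rt0 ht0 hcover /andP[q0 q1] c0 hq.
apply: ge0_integrable_bound => //.
pose B k := [set z : 'rV[R]_n | enorm z <= rt k].
have mB k : measurable (B k) by exact: measurable_enorm_le.
pose F k z : \bar R := (ht k * \1_(B k) z)%:E.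
have mF k : measurable_fun setT (F k).
  by apply/measurable_EFinP; apply: measurable_funM => //; exact: measurable_indic.
have F0 k z : (0 <= F k z)%E by rewrite lee_fin mulr_ge0.
apply: (@le_trans _ _ (\int[mu]_z \sum_(0 <= k <oo) F k z)%E).
  apply: ge0_le_integral => //.
  - by move=> z _; rewrite lee_fin.
  - exact/measurable_EFinP.
  - by apply: ge0_emeasurable_sum => // k z _ _; exact: F0.
  move=> z _; have := h0 z; rewrite le_eqVlt => /predU1P[<-|hz].
    by apply: nneseries_ge0 => k _ _; exact: F0.
  have [k [zk hk]] := hcover z hz.
  apply: le_trans; last by apply: (nneseries_lim_ge k.+1) => i _ _; exact: F0.
  rewrite big_nat_recr//= (@le_trans _ _ (F k z))//.
    by rewrite /F lee_fin indicE mem_set ?mulr1.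
  by rewrite leeDr// sume_ge0.
rewrite integral_nneseries//.
apply: lime_le.
  by apply: is_cvg_nneseries => k _ _; apply: integral_ge0.
apply: nearW => m.
apply: (@le_trans _ _ (\sum_(0 <= k < m) (c * q ^+ k)%:E)%E).
  apply: lee_sum => k _.
  rewrite /F; under eq_integral do rewrite EFinM.
  rewrite ge0_integralZl_EFin//; last first.
    by apply/measurable_EFinP; exact: measurable_indic.
  rewrite integral_indic// setIT (le_trans _ (_ : (ht k * (4 * rt k) ^+ n)%:E <= _)%E)//.
    by rewrite EFinM lee_wpmul2l// ?lee_fin// lebesgue_rV_enorm_le.
  by rewrite lee_fin.
rewrite sumEFin lee_fin -mulr_sumr ler_wpM2l//.
have q1' : 1 - q != 0 by rewrite subr_eq0 eq_sym lt_eqF.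
rewrite big_mkord -(ler_pM2l (_ : 0 < 1 - q)) ?subr_gt0// divff//.
have := subrX1 q m; rewrite -opprB => /(congr1 -%R).
rewrite opprK -mulNr opprB => <-.
by rewrite lerBlDr lerDl exprn_ge0.
Qed.

End lebesgue_rV_bounds.

(** * Dyadic scales and integrals of the singular kernel *)

Section dyadic_scales.
Context {R : realType}.

Lemma dyadic_scale (r x : R) : 0 < r -> r <= x ->
  exists k, 2 ^+ k * r <= x < 2 ^+ k.+1 * r.
Proof.
move=> r0 rx.
have exk : exists k, x < 2 ^+ k.+1 * r.
  exists (Num.truncn (x / r)).+1; rewrite -ltr_pdivrMr//.
  apply: lt_le_trans (truncnS_gt (x / r)) _.
  rewrite -natrX ler_nat; apply: leq_trans (ltnW (ltn_expl _ (ltnSn 1))) _.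
  by rewrite leq_exp2l.
case: (ex_minnP exk) => -[x1 _|k xk kmin].
  by exists 0%N; rewrite expr0 mul1r rx.
by exists k.+1; rewrite xk andbT leNgt; apply/negP => /kmin; rewrite ltnn.
Qed.

Lemma powR_exprn (a s : R) k : 0 <= a -> (a ^+ k) `^ s = (a `^ s) ^+ k.
Proof.
by move=> a0; rewrite -powR_mulrn// -powRrM mulrC powRrM powR_mulrn// powR_ge0.
Qed.

(** The singular kernel at distance [a] times the volume of a cube of side proportional to [a]: the
    dimension cancels. *)
Lemma powR_scale (N : nat) (a c t : R) : 0 < a ->
  (a `^ (N%:R + t))^-1 * (c * a) ^+ N = c ^+ N * a `^ (- t).
Proof.
move=> a0; have -> : a `^ (N%:R + t) = a ^+ N * a `^ t.
  rewrite -powR_mulrn ?ltW// -powRD//; apply/implyP => _.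
  by rewrite gt_eqF.
rewrite exprMn powRN.
have aN : a ^+ N != 0 by rewrite expf_neq0// gt_eqF.
have at0 : a `^ t != 0 by rewrite gt_eqF// powR_gt0.
by field; rewrite aN at0.
Qed.

Lemma measurable_inv_fun d (T : measurableType d) (g : T -> R) :
  measurable_fun setT g -> (forall z, 0 <= g z) ->
  measurable_fun setT (fun z => (g z)^-1).
Proof.
move=> mg g0; rewrite (_ : (fun _ => _) = fun z => g z `^ (-1)); last first.
  by apply/funext => z; rewrite powR_inv1.
by apply: (measurableT_comp (measurable_powR (-1))).
Qed.

End dyadic_scales.

Section kernels.
Context {R : realType} {n : nat}.
Variable sigma : R.
Hypothesis sigma01 : 0 < sigma < 1.
Local Notation N := (n.+1%:R : R).
Local Notation p := (n.+1%:R + 2 * sigma : R).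
Local Notation mu := (lebesgue_rV n.+1 : {measure set 'rV[R]_n.+1 -> \bar R}).
Implicit Types (r : R) (z : 'rV[R]_n.+1).

Definition far_kernel r z : R :=
  if r <= enorm z then (enorm z `^ p)^-1 else 0.

Definition near_moment r z : R :=
  if enorm z < r then nsq z / enorm z `^ p else 0.

Lemma kernel_exponent_gt0 : 0 < p.
Proof. by have /andP[s0 _] := sigma01; rewrite addr_gt0// mulr_gt0. Qed.

Lemma measurable_enorm_powR (s : R) :
  measurable_fun setT (fun z : 'rV[R]_n.+1 => enorm z `^ s).
Proof.
by apply: (measurableT_comp (measurable_powR s)); exact: measurable_enorm.
Qed.

Lemma measurable_far_kernel r : measurable_fun setT (far_kernel r).
Proof.
apply: measurable_fun_ifT => //.
  apply: (measurable_fun_bool true); rewrite setTI.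
  rewrite (_ : _ @^-1` _ = ~` [set z | enorm z < r]).
    by apply: measurableC; exact: measurable_enorm_lt.
  by apply/seteqP; split => z /=; [move=> H; apply/negP; rewrite -leNgt|move/negP; rewrite -leNgt].
by apply: measurable_inv_fun => [|z]; [exact: measurable_enorm_powR|exact: powR_ge0].
Qed.

Lemma measurable_near_moment r : measurable_fun setT (near_moment r).
Proof.
apply: measurable_fun_ifT => //.
  by apply: (measurable_fun_bool true); rewrite setTI; exact: measurable_enorm_lt.
apply: measurable_funM; first exact: measurable_nsq.
by apply: measurable_inv_fun => [|z]; [exact: measurable_enorm_powR|exact: powR_ge0].
Qed.

Lemma far_kernel_ge0 r z : 0 <= far_kernel r z.
Proof. by rewrite /far_kernel; case: ifP => // _; rewrite invr_ge0 powR_ge0. Qed.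

Lemma near_moment_ge0 r z : 0 <= near_moment r z.
Proof.
rewrite /near_moment; case: ifP => // _.
by rewrite divr_ge0 ?powR_ge0 ?nsq_ge0.
Qed.

(* The sums of the geometric series over the dyadic shells outside and inside
   the ball of radius [r]. *)
Definition far_const : R := 8 ^+ n.+1 / (1 - 2 `^ (- (2 * sigma))).

Definition near_const : R := 4 ^+ n.+1 * 2 `^ p / (1 - (2^-1) `^ (2 - 2 * sigma)).

Lemma powR_lt1 (a s : R) : 0 < a < 1 -> 0 < s -> 0 <= a `^ s < 1.
Proof.
move=> /andP[a0 a1] s0; rewrite powR_ge0/=.
have := @gt0_ltr_powR R s s0 a 1; rewrite powR1; apply => //;
by rewrite nnegrE ?ltW.
Qed.

Lemma far_ratio : 0 <= 2 `^ (- (2 * sigma)) < 1.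
Proof.
have /andP[s0 _] := sigma01.
rewrite (_ : 2 `^ _ = 2^-1 `^ (2 * sigma)); last first.
  by rewrite -powR_inv1// -powRrM mulN1r.
by apply: powR_lt1; [apply/andP; split; lra|rewrite mulr_gt0].
Qed.

Lemma near_ratio : 0 <= (2^-1 : R) `^ (2 - 2 * sigma) < 1.
Proof. by have /andP[s0 s1] := sigma01; apply: powR_lt1; [apply/andP; split|]; lra. Qed.

Lemma far_const_gt0 : 0 < far_const.
Proof.
by have /andP[_ q1] := far_ratio; rewrite divr_gt0 ?exprn_gt0// subr_gt0.
Qed.

Lemma near_const_gt0 : 0 < near_const.
Proof.
have /andP[_ q1] := near_ratio.
by rewrite divr_gt0 ?subr_gt0// mulr_gt0 ?exprn_gt0 ?powR_gt0.
Qed.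

(** On the shell 2^k r <= |z| < 2^(k+1) r the kernel is at most its value at the inner radius, which
    gives bounds of ratio 2^(-2 sigma). The base 8 in [far_const] is 4 from the volume bound times 2
    from the outer radius. *)
Lemma far_kernel_integral r : 0 < r ->
  mu.-integrable setT (EFin \o far_kernel r) /\
  \int[mu]_z far_kernel r z <= far_const * r `^ (- (2 * sigma)).
Proof.
move=> r0; have p0 := kernel_exponent_gt0.
have a0 k : 0 < 2 ^+ k * r by rewrite mulr_gt0// exprn_gt0.
rewrite /far_const mulrAC.
apply: (@dyadic_integral_bound _ _ _ (fun k => ((2 ^+ k * r) `^ p)^-1)
  (fun k => 2 ^+ k.+1 * r)) => //.
- exact: measurable_far_kernel.
- exact: far_kernel_ge0.
- by move=> k; rewrite invr_ge0 powR_ge0.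
- move=> z; rewrite /far_kernel; case: ifPn => [rz _|]; last by rewrite ltxx.
  have [k /andP[kz zk]] := dyadic_scale r0 rz.
  have z0 : 0 < enorm z := lt_le_trans r0 rz.
  exists k; split; first exact: ltW.
  rewrite lef_pV2 ?posrE ?powR_gt0//.
  by rewrite ge0_ler_powR ?nnegrE ?(ltW p0) ?(ltW z0) ?(ltW (a0 k)).
- exact: far_ratio.
- by rewrite mulr_ge0 ?exprn_ge0 ?powR_ge0.
move=> k; rewrite (_ : 4 * _ = 8 * (2 ^+ k * r)); last by rewrite exprS; ring.
rewrite powR_scale// powRM ?exprn_ge0 ?(ltW r0)// powR_exprn//.
by rewrite le_eqVlt; apply/orP; left; apply/eqP; ring.
Qed.

(** Now the shells shrink to the origin: |z|^2 is taken at the outer radius and the kernel at the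
    inner one, half as large, whence the factor 2^p in [near_const]. The series converges because
    sigma < 1. *)
Lemma near_moment_integral r : 0 < r ->
  mu.-integrable setT (EFin \o near_moment r) /\
  \int[mu]_z near_moment r z <= near_const * r `^ (2 - 2 * sigma).
Proof.
move=> r0; have p0 := kernel_exponent_gt0.
have a0 k : 0 < 2^-1 ^+ k * r by rewrite mulr_gt0// exprn_gt0.
rewrite /near_const mulrAC.
apply: (@dyadic_integral_bound _ _ _
  (fun k => (2^-1 ^+ k * r) ^+ 2 / (2^-1 * (2^-1 ^+ k * r)) `^ p)
  (fun k => 2^-1 ^+ k * r)) => //.
- exact: measurable_near_moment.
- exact: near_moment_ge0.
- by move=> k; rewrite divr_ge0 ?powR_ge0// sqr_ge0.
- move=> z; rewrite /near_moment; case: ifPn => [zr hz|]; last by rewrite ltxx.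
  have z0 : 0 < enorm z.
    rewrite lt_def enorm_ge0 andbT; apply: contraTneq hz => z0.
    by rewrite -sqr_enorm z0 expr0n mul0r ltxx.
  (* The unit is [enorm z] and the point is [r]: this counts the halvings of [r] down to |z|. *)
  have [k /andP[kz zk]] := dyadic_scale z0 (ltW zr).
  have zk1 : enorm z <= 2^-1 ^+ k * r.
    by rewrite exprVn mulrC ler_pdivlMr ?exprn_gt0// mulrC.
  have zk2 : 2^-1 * (2^-1 ^+ k * r) <= enorm z.
    by rewrite mulrA -exprS exprVn mulrC ler_pdivrMr ?exprn_gt0// mulrC ltW.
  exists k; split=> //; rewrite -sqr_enorm ler_pM ?sqr_ge0 ?invr_ge0 ?powR_ge0//.
    by rewrite ler_sqr ?nnegrE ?enorm_ge0// ltW.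
  rewrite lef_pV2 ?posrE ?powR_gt0//; last by rewrite mulr_gt0.
  by rewrite ge0_ler_powR ?nnegrE ?enorm_ge0 ?(ltW p0)// mulr_ge0// ltW.
- exact: near_ratio.
- by rewrite !mulr_ge0 ?exprn_ge0 ?powR_ge0.
move=> k; have b0 := a0 k; set b := _ * r in b0 *.
rewrite (_ : _ * _ ^+ n.+1 = 2 `^ p * 4 ^+ n.+1 * (b ^+ 2 * b `^ (- (2 * sigma)))).
  rewrite -[X in _ * X](_ : b `^ (2 - 2 * sigma) = _); last first.
    rewrite -[b ^+ 2]powR_mulrn ?(ltW b0)// -powRD//.
    by apply/implyP => _; rewrite gt_eqF.
  rewrite /b powRM ?exprn_ge0 ?(ltW r0) ?invr_ge0// powR_exprn//.
  by rewrite le_eqVlt; apply/orP; left; apply/eqP; ring.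
have h2 : (2^-1 `^ p)^-1 = 2 `^ p :> R.
  by rewrite -powRN -[X in X `^ _]powR_inv1// -powRrM mulN1r opprK.
rewrite powRM ?(ltW b0)// invfM h2.
have E := powR_scale n.+1 4 (2 * sigma) b0.
transitivity (2 `^ p * b ^+ 2 * ((b `^ p)^-1 * (4 * b) ^+ n.+1)).
  by set x := (4 * b) ^+ _; ring.
by rewrite E; ring.
Qed.

End kernels.
Arguments far_const {R} n sigma.
Arguments near_const {R} n sigma.

(** * Integrals of bounded functions and of paraboloids against a kernel *)

Section rV_integrals.
Context {R : realType} {n : nat}.
Local Notation mu := (lebesgue_rV n : {measure set 'rV[R]_n -> \bar R}).
Implicit Types (f g h k : 'rV[R]_n -> R).

Definition rV_integrable h := mu.-integrable setT (EFin \o h).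

Lemma rV_integrable_measurable h : rV_integrable h -> measurable_fun setT h.
Proof. by case/integrableP => /measurable_EFinP. Qed.

Lemma rV_integrableD f g : rV_integrable f -> rV_integrable g ->
  rV_integrable (fun z => f z + g z).
Proof. by move=> jf jg; exact: (integrableD measurableT jf jg). Qed.

Lemma rV_integrableZ (c : R) f : rV_integrable f ->
  rV_integrable (fun z => c * f z).
Proof. by move=> jf; exact: (integrableZl measurableT c jf). Qed.

Lemma rV_integrableM (B : R) g k : measurable_fun setT g ->
  (forall z, `|g z| <= B) -> rV_integrable k -> rV_integrable (fun z => g z * k z).
Proof.
move=> mg gB jk; apply: (@le_integrable_fin _ _ _ (fun z => B * `|k z|)).
- by apply: measurable_funM => //; exact: rV_integrable_measurable.
- by move=> z; rewrite normrM ler_wpM2r.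
exact/rV_integrableZ/integrable_norm.
Qed.

Lemma rV_integralD f g : rV_integrable f -> rV_integrable g ->
  \int[mu]_z (f z + g z) = \int[mu]_z f z + \int[mu]_z g z.
Proof. by move=> jf jg; exact: RintegralD. Qed.

Lemma rV_integralZ (c : R) f : rV_integrable f ->
  \int[mu]_z (c * f z) = c * \int[mu]_z f z.
Proof. by move=> jf; exact: RintegralZl. Qed.

Lemma rV_le_integral f g : rV_integrable f -> rV_integrable g ->
  (forall z, f z <= g z) -> \int[mu]_z f z <= \int[mu]_z g z.
Proof. by move=> jf jg fg; apply: le_Rintegral. Qed.

Lemma rV_eq_integral f g : f =1 g -> \int[mu]_z f z = \int[mu]_z g z.
Proof. by move=> fg; apply: eq_Rintegral => z _; exact: fg. Qed.

Lemma rV_eq_integrable f g : f =1 g -> rV_integrable f -> rV_integrable g.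
Proof. by move/funext->. Qed.

Lemma rV_integrable_indic (A : set 'rV[R]_n) : measurable A ->
  (mu A < +oo)%E -> rV_integrable (\1_A).
Proof.
move=> mA Aoo; apply/integrableP; split.
  by apply/measurable_EFinP; exact: measurable_indic.
rewrite (eq_integral (fun z => (\1_A z)%:E)); last first.
  by move=> z _ /=; rewrite ger0_norm.
by rewrite integral_indic// setIT.
Qed.

Lemma rV_integral_box (a : 'I_n -> R) (l : R) : 0 <= l ->
  let A := [set v : 'rV[R]_n | forall i, a i < v ord0 i <= a i + l] in
  rV_integrable (\1_A) /\ \int[mu]_z \1_A z = l ^+ n.
Proof.
move=> l0 A; have mA : measurable A by exact: measurable_box.
have muA : mu A = (l ^+ n)%:E.
  apply: etrans (lebesgue_rV_box a (fun i => a i + l)) _; congr (_%:E).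
  rewrite (eq_bigr (fun=> l)) ?prodr_const ?card_ord// => i _.
  by rewrite addrAC subrr add0r max_l.
split; first by apply: rV_integrable_indic; rewrite ?muA ?ltry.
by rewrite /Rintegral integral_indic// setIT muA.
Qed.

End rV_integrals.

Section quadratic_integrals.
Context {R : realType} {n : nat}.
Local Notation mu := (lebesgue_rV n : {measure set 'rV[R]_n -> \bar R}).
Implicit Types (c z : 'rV[R]_n).

Lemma nsq_coord_le z i : z ord0 i ^+ 2 <= nsq z.
Proof.
by rewrite /nsq (bigD1 i)//= lerDl sumr_ge0// => j _; exact: sqr_ge0.
Qed.

Lemma dotr_le c z : `|dotr c z| <= nsq c + nsq z.
Proof.
have := nsq_ge0 (c + z); have := nsq_ge0 (c - z).
rewrite !nsqD nsqN dotrN ler_norml; have := nsq_ge0 c; have := nsq_ge0 z.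
by move=> *; apply/andP; split; lra.
Qed.

(* The linear part integrates to 0 because the kernel is even. *)
Lemma quadratic_integral (k : 'rV[R]_n -> R) (r : R) c (a : R) :
  0 <= r -> rV_integrable k -> (forall z, k (- z) = k z) ->
  (forall z, r < enorm z -> k z = 0) ->
  rV_integrable (fun z => (dotr c z + a * nsq z) * k z) /\
  rV_integrable (fun z => nsq z * k z) /\
  \int[mu]_z ((dotr c z + a * nsq z) * k z) = a * \int[mu]_z (nsq z * k z).
Proof.
move=> r0 jk kN k0; have mk := rV_integrable_measurable jk.
have bound (g : 'rV[R]_n -> R) (B : R) : 0 <= B -> measurable_fun setT g ->
    (forall z, nsq z <= r ^+ 2 -> `|g z| <= B) ->
    rV_integrable (fun z => g z * k z).
  move=> B0 mg gB; apply: (@le_integrable_fin _ _ _ (fun z => B * `|k z|)).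
  - exact: measurable_funM.
  - move=> z; rewrite normrM; have [zr|zr] := leP (enorm z) r.
      by rewrite ler_wpM2r// gB// -enorm_leE.
    by rewrite k0// normr0 !mulr0.
  exact/rV_integrableZ/integrable_norm.
have jn : rV_integrable (fun z => nsq z * k z).
  apply: (bound _ (r ^+ 2)); first exact: sqr_ge0.
    exact: measurable_nsq.
  by move=> z zr; rewrite ger0_norm// nsq_ge0.
have jd : rV_integrable (fun z => dotr c z * k z).
  apply: (bound _ (nsq c + r ^+ 2)).
  - by rewrite addr_ge0 ?nsq_ge0 ?sqr_ge0.
  - exact: measurable_dotr.
  by move=> z zr; apply: le_trans (dotr_le c z) _; rewrite lerD2l.
have E z : (dotr c z + a * nsq z) * k z = dotr c z * k z + a * (nsq z * k z).
  by ring.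
split; last split => //.
  apply: rV_eq_integrable (fun z => esym (E z)) _.
  exact/rV_integrableD/rV_integrableZ.
rewrite (rV_eq_integral E) rV_integralD//; last exact: rV_integrableZ.
rewrite rV_integralZ// Rintegral_odd ?add0r// => z.
by rewrite kN dotrN mulNr.
Qed.

End quadratic_integrals.

(** * The regularized kernel compared with the singular one *)

Section kernel_facts.
Context {R : realType} {n : nat}.
Variable sigma : R.
Hypothesis sigma01 : 0 < sigma < 1.
Local Notation p := (n.+1%:R + 2 * sigma : R).
Local Notation mu := (lebesgue_rV n.+1 : {measure set 'rV[R]_n.+1 -> \bar R}).
Implicit Types (r eps : R) (z : 'rV[R]_n.+1).
Let p0 : 0 < p := kernel_exponent_gt0 sigma01.

Lemma kernel_epsN eps z : kernel_eps sigma eps (- z) = kernel_eps sigma eps z.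
Proof. by rewrite /kernel_eps enormN. Qed.

Lemma kernel_eps_ge0 eps z : 0 <= kernel_eps sigma eps z.
Proof. by rewrite invr_ge0 addr_ge0 ?powR_ge0. Qed.

Lemma measurable_kernel_eps eps :
  measurable_fun setT (@kernel_eps R n sigma eps).
Proof.
apply: measurable_inv_fun => [|z]; last by rewrite addr_ge0 ?powR_ge0.
by apply: measurable_funD => //; exact: measurable_enorm_powR.
Qed.

Lemma kernel_eps_le eps z : 0 <= eps -> 0 < enorm z ->
  kernel_eps sigma eps z <= (enorm z `^ p)^-1.
Proof.
move=> e0 z0; rewrite lef_pV2 ?posrE ?powR_gt0 ?ltr_wpDl ?powR_ge0 ?powR_gt0//.
by rewrite lerDr powR_ge0.
Qed.

Lemma kernel_eps_le_far r eps z : 0 < r -> 0 <= eps -> r <= enorm z ->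
  kernel_eps sigma eps z <= far_kernel sigma r z.
Proof.
move=> r0 e0 rz; rewrite /far_kernel rz kernel_eps_le//.
exact: lt_le_trans rz.
Qed.

Lemma nsq_kernel_eps_le eps z : 0 <= eps ->
  nsq z * kernel_eps sigma eps z <= nsq z / enorm z `^ p.
Proof.
move=> e0; have := enorm_ge0 z; rewrite le_eqVlt => /predU1P[z0|z0].
  by rewrite -sqr_enorm -z0 expr0n !mul0r.
by rewrite ler_wpM2l ?nsq_ge0// kernel_eps_le.
Qed.

Lemma kernel_eps_ge r eps z : 0 < eps -> enorm z <= r ->
  (eps `^ p + r `^ p)^-1 <= kernel_eps sigma eps z.
Proof.
move=> e0 zr; rewrite lef_pV2 ?posrE ?ltr_pwDl ?powR_ge0 ?powR_gt0//.
by rewrite lerD2l ge0_ler_powR ?nnegrE ?(ltW p0)//;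
  [exact: enorm_ge0|exact: le_trans (enorm_ge0 z) zr].
Qed.

(** With E = eps^p and Z = |z|^p >= r^p, the relative error of the kernel is E/(E+Z) <= (eps/r)^p,
    which vanishes as eps tends to 0 with [r] fixed. *)
Lemma far_kernel_sub_eps r eps z : 0 < r -> 0 < eps -> r <= enorm z ->
  `|far_kernel sigma r z - kernel_eps sigma eps z|
    <= (eps / r) `^ p * far_kernel sigma r z.
Proof.
move=> r0 e0 rz; rewrite ger0_norm ?subr_ge0 ?kernel_eps_le_far ?(ltW e0)//.
have z0 : 0 < enorm z := lt_le_trans r0 rz.
rewrite /far_kernel rz/= /kernel_eps.
have Z0 : 0 < enorm z `^ p by exact: powR_gt0.
have E0 : 0 < eps `^ p by exact: powR_gt0.
have r0' : 0 < r `^ p by exact: powR_gt0.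
have rZ : r `^ p <= enorm z `^ p.
  by rewrite ge0_ler_powR ?nnegrE ?(ltW p0) ?(ltW r0) ?enorm_ge0.
rewrite powRM ?invr_ge0 ?(ltW e0) ?(ltW r0)//.
rewrite (_ : r^-1 `^ p = (r `^ p)^-1); last first.
  by rewrite -(powR_inv1 (ltW r0)) -powRrM mulN1r powRN.
set Z := enorm z `^ p in Z0 rZ *; set E := eps `^ p in E0 *.
set P := r `^ p in r0' rZ *.
rewrite (_ : Z^-1 - _ = E / (E + Z) * Z^-1); last first.
  by field; rewrite !gt_eqF ?addr_gt0.
rewrite ler_pM2r ?invr_gt0// ler_pM2l// lef_pV2 ?posrE ?addr_gt0//.
by rewrite (le_trans rZ)// lerDr ltW.
Qed.

(** The kernel is at most eps^(-p) on the unit ball and below the singular kernel outside. *)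
Lemma kernel_eps_integrable eps : 0 < eps ->
  rV_integrable (@kernel_eps R n sigma eps).
Proof.
move=> e0; have [jf _] := @far_kernel_integral R n sigma sigma01 1 ltr01.
have jb : rV_integrable (\1_[set z : 'rV[R]_n.+1 | enorm z <= 1]).
  apply: rV_integrable_indic; first exact: measurable_enorm_le.
  exact: le_lt_trans (lebesgue_rV_enorm_le ltr01) (ltry _).
apply: (le_integrable_fin (measurable_kernel_eps eps)); last first.
  exact: (rV_integrableD (rV_integrableZ (eps `^ p)^-1 jb) jf).
move=> z; rewrite ger0_norm ?kernel_eps_ge0// indicE.
have [z1|z1] := leP (enorm z) 1.
  rewrite mem_set// mulr1 (le_trans _ (_ : (eps `^ p)^-1 <= _))//.
    rewrite lef_pV2 ?posrE ?ltr_pwDl ?powR_ge0 ?powR_gt0//.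
    by rewrite lerDl powR_ge0.
  by rewrite lerDl far_kernel_ge0.
rewrite memNset/= ?mulr0 ?add0r; last by apply/negP; rewrite -ltNge.
by rewrite kernel_eps_le_far// ltW.
Qed.

End kernel_facts.

(** * The normalizing constant *)

Section normalizing_constant.
Context {R : realType}.

Lemma sin_lipschitz0 (x : R) : `|sin x| <= `|x|.
Proof.
wlog x0 : x / 0 <= x => [H|].
  by have [/H//|/ltW x0] := leP 0 x; rewrite -normrN -sinN -(normrN x) H// oppr_ge0.
have [c _] := @MVT_segment R sin cos 0 x x0
  (fun y _ => is_derive_sin y) (continuous_subspaceT (@continuous_sin R)).
rewrite sin0 !subr0 => ->; rewrite normrM -[leRHS]mul1r ler_wpM2r//.
exact: cos_max.
Qed.

Lemma one_sub_cos_le (x : R) : 1 - cos x <= x ^+ 2.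
Proof.
wlog x0 : x / 0 <= x => [H|].
  by have [/H//|/ltW x0] := leP 0 x; rewrite -cosN -sqrrN H// oppr_ge0.
have [c] := @MVT_segment R cos (fun y => - sin y) 0 x x0
  (fun y _ => is_derive_cos y) (continuous_subspaceT (@continuous_cos R)).
rewrite in_itv/= cos0 subr0 => /andP[c0 cx] E.
rewrite -opprB E mulNr opprK expr2 ler_wpM2r//.
rewrite (le_trans (ler_norm _))// (le_trans (sin_lipschitz0 c))// ger0_norm//.
Qed.

Context (n : nat) (sigma : R).
Hypothesis sigma01 : 0 < sigma < 1.
Local Notation p := (n.+1%:R + 2 * sigma : R).

(** The integral is taken as a real number, so finiteness comes first: 1 - cos t is at most t^2,
    used near the origin, and at most 2, used far away. Positivity comes from the cube (1,2]^N,
    where 1 - cos is at least 1 - cos 1 because cos decreases on [0,pi]. *)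
Lemma norm_const_gt0 : 0 < norm_const n sigma.
Proof.
have p0 : 0 < p := kernel_exponent_gt0 sigma01.
pose h (z : 'rV[R]_n.+1) := (1 - cos (z ord0 ord0)) / enorm z `^ p.
have h0 z : 0 <= h z by rewrite divr_ge0 ?powR_ge0// subr_ge0 cos_le1.
have mh : measurable_fun setT h.
  apply: measurable_funM.
    apply: measurable_funB => //.
    apply: (measurableT_comp (f := @cos R)); last exact: measurable_coord.
    by apply: continuous_measurable_fun; exact: continuous_cos.
  apply: measurable_inv_fun => [|z]; last exact: powR_ge0.
  exact: measurable_enorm_powR.
have [jf _] := @far_kernel_integral R n sigma sigma01 1 ltr01.
have [jn _] := @near_moment_integral R n sigma sigma01 1 ltr01.
have jh : rV_integrable h.
  apply: (le_integrable_fin mh) (rV_integrableD jn (rV_integrableZ 2 jf)).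
  move=> z; rewrite ger0_norm// /near_moment /far_kernel /h.
  case: (ltP (enorm z) 1) => z1.
    rewrite mulr0 addr0 ler_wpM2r ?invr_ge0 ?powR_ge0//.
    by rewrite (le_trans (one_sub_cos_le _))// nsq_coord_le.
  rewrite add0r ler_wpM2r ?invr_ge0 ?powR_ge0//.
  by have := cos_geN1 (z ord0 ord0); lra.
have [jb Eb] := @rV_integral_box R n.+1 (fun=> 1) 1 ler01.
set A := [set v | _] in jb Eb.
pose rho : R := n.+1%:R * 2.
pose c := (1 - cos 1) / rho `^ p.
have cos1 : cos 1 < 1 :> R.
  rewrite -[ltRHS](@cos0 R) ltr_cos ?ltr01// in_itv/= ?lexx ?pi_ge0// ler01/=.
  by have := pihalf_ge1 R; lra.
have c0 : 0 < c by rewrite divr_gt0 ?subr_gt0 ?powR_gt0 ?mulr_gt0.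
apply: (@lt_le_trans _ _ (c * 1 ^+ n.+1)); first by rewrite expr1n mulr1.
rewrite -Eb -rV_integralZ//; apply: rV_le_integral => //.
  exact: rV_integrableZ.
move=> z; rewrite indicE; case: (boolP (z \in A)) => [|_]; last first.
  by rewrite mulr0; exact: h0.
rewrite inE mulr1 => Az.
have z0 i : 1 < z ord0 i <= 2 by have := Az i.
have zrho : enorm z <= rho.
  apply: enorm_le_coord => // i; have /andP[z1 z2] := z0 i.
  by rewrite ger0_norm// (le_trans _ (ltW z1)).
have /andP[z1 z2] := z0 ord0.
have zpos : 0 < enorm z.
  by apply: lt_le_trans (coord_le_enorm z ord0); rewrite normr_gt0; lra.
rewrite /c /h ler_pM ?invr_ge0 ?powR_ge0 ?subr_ge0 ?cos_le1//.
  have := pihalf_ge1 R => pi2.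
  by rewrite lerD2l lerN2 ltW// ltr_cos ?in_itv//=; apply/andP; split; lra.
rewrite lef_pV2 ?posrE ?powR_gt0 ?mulr_gt0//.
by rewrite ge0_ler_powR ?nnegrE ?enorm_ge0 ?(ltW p0)//; lra.
Qed.

End normalizing_constant.

(** * Test functions and the principal value *)

Section principal_value.
Context {R : realType} {n : nat}.
Variable sigma : R.
Hypothesis sigma01 : 0 < sigma < 1.
Local Notation p := (n.+1%:R + 2 * sigma : R).
Local Notation mu := (lebesgue_rV n.+1 : {measure set 'rV[R]_n.+1 -> \bar R}).
Implicit Types (z c : 'rV[R]_n.+1) (r t a : R).

Lemma far_kernelN r z : far_kernel sigma r (- z) = far_kernel sigma r z.
Proof. by rewrite /far_kernel enormN. Qed.

Definition shell_kernel t r z : R := far_kernel sigma t z - far_kernel sigma r z.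

Lemma shell_kernelE t r z : t <= r -> shell_kernel t r z =
  if (t <= enorm z) && (enorm z < r) then (enorm z `^ p)^-1 else 0.
Proof.
move=> tr; rewrite /shell_kernel /far_kernel.
have [rz|zr] := leP r (enorm z).
  by rewrite (le_trans tr rz)/= subrr.
by rewrite subr0 andbT.
Qed.

Lemma shell_kernel_ge0 t r z : t <= r -> 0 <= shell_kernel t r z.
Proof.
by move=> tr; rewrite shell_kernelE//; case: ifP => // _; rewrite invr_ge0 powR_ge0.
Qed.

Lemma far_kernel_integrable r : 0 < r -> rV_integrable (@far_kernel R n sigma r).
Proof. by move=> r0; case: (@far_kernel_integral R n sigma sigma01 r r0). Qed.

Lemma shell_kernel_integrable t r : 0 < t -> t <= r ->
  rV_integrable (shell_kernel t r).
Proof.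
move=> t0 tr; have r0 : 0 < r := lt_le_trans t0 tr.
have := rV_integrableD (far_kernel_integrable t0)
  (rV_integrableZ (-1) (far_kernel_integrable r0)).
by apply: rV_eq_integrable => z; rewrite mulN1r.
Qed.

Lemma shell_moment_le t r z : t <= r ->
  nsq z * shell_kernel t r z <= near_moment sigma r z.
Proof.
move=> tr; rewrite shell_kernelE//; case: ifPn => [/andP[_ zr]|_].
  by rewrite /near_moment zr.
by rewrite mulr0 near_moment_ge0.
Qed.

Lemma shell_quadratic_integral t r c a : 0 < t -> t <= r ->
  rV_integrable (fun z => (dotr c z + a * nsq z) * shell_kernel t r z) /\
  rV_integrable (fun z => nsq z * shell_kernel t r z) /\
  \int[mu]_z ((dotr c z + a * nsq z) * shell_kernel t r z) =
  a * \int[mu]_z (nsq z * shell_kernel t r z).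
Proof.
move=> t0 tr; apply: (@quadratic_integral _ _ _ r).
- exact: le_trans (ltW t0) tr.
- exact: shell_kernel_integrable.
- by move=> z; rewrite /shell_kernel !far_kernelN.
- by move=> z rz; rewrite shell_kernelE// [enorm z < r]ltNge (ltW rz) andbF.
Qed.

Lemma shell_moment_integral_le t r : 0 < t -> t <= r ->
  \int[mu]_z (nsq z * shell_kernel t r z) <= near_const n sigma * r `^ (2 - 2 * sigma).
Proof.
move=> t0 tr; have r0 : 0 < r := lt_le_trans t0 tr.
have [_ [js _]] := @shell_quadratic_integral t r 0 0 t0 tr.
have [jn nb] := @near_moment_integral R n sigma sigma01 r r0.
apply: le_trans nb; apply: rV_le_integral => // z.
exact: shell_moment_le.
Qed.

(** The integral truncated at t <= r splits into [a * j t], as the linear part of the paraboloid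
    cancels, and a part [T] independent of t. As t decreases, j(t) increases and stays bounded; so
    the principal value is a genuine limit, and [J] is the limit of [j]. *)
Lemma pv_integral_patch (u phi : 'rV[R]_n.+1 -> R) (U : R) x r c a :
  measurable_fun setT u -> (forall y, `|u y| <= U) -> 0 < r ->
  (forall z, phi (x + z) = phi x + (dotr c z + a * nsq z)) -> phi x = u x ->
  exists J, 0 <= J <= near_const n sigma * r `^ (2 - 2 * sigma) /\
    pv_integral sigma (patch u (eball x r) phi) x =
    a * J + \int[mu]_z ((u (x + z) - u x) * far_kernel sigma r z).
Proof.
move=> mu_ uU r0 phiE phix; set v := patch u _ _; set T := \int[mu]_z _.
pose tr (t : R) := \int[mu]_(z in [set z | t <= enorm z])
  ((v (x + z) - v x) / enorm z `^ p).
pose j (t : R) := \int[mu]_z (nsq z * shell_kernel t r z).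
have mdu : measurable_fun setT (fun z => u (x + z) - u x).
  apply: measurable_funB => //; apply: (measurableT_comp mu_).
  exact: measurable_addl_rV.
have jdu : rV_integrable (fun z => (u (x + z) - u x) * far_kernel sigma r z).
  apply: (rV_integrableM (B := U + U)) => //; last exact: far_kernel_integrable.
  by move=> z; rewrite (le_trans (ler_normB _ _))// lerD.
have vx : v x = u x.
  by rewrite /v /patch; case: ifP.
have trE t : 0 < t -> t <= r -> tr t = a * j t + T.
  move=> t0 tler; have [jq [_ Eq]] := @shell_quadratic_integral t r c a t0 tler.
  rewrite -Eq -rV_integralD// /tr Rintegral_mkcond; apply: rV_eq_integral => z.
  rewrite patchE shell_kernelE// vx /v /patch.
  have [tz|zt] := leP t (enorm z); last first.
    rewrite memNset/=; last by apply/negP; rewrite -ltNge.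
    by rewrite mulr0 /far_kernel leNgt (lt_le_trans zt tler)/= mulr0 addr0.
  rewrite mem_set//= /far_kernel [enorm z < r]ltNge.
  have [rz|zr] := leP r (enorm z).
    rewrite memNset/= ?mulr0 ?add0r//.
    by rewrite /eball/= addrAC subrr add0r; apply/negP; rewrite -leNgt.
  rewrite mem_set/=; last by rewrite /eball/= addrAC subrr add0r.
  by rewrite mulr0 addr0 phiE phix addrAC subrr add0r.
have near_r : \forall t \near (0:R)^'+, 0 < t <= r.
  near=> t; apply/andP; split; near: t; first exact: nbhs_right_gt.
  exact: nbhs_right_le.
have jle t : 0 < t -> t <= r -> j t <= near_const n sigma * r `^ (2 - 2 * sigma).
  exact: shell_moment_integral_le.
have jge t : 0 < t -> t <= r -> 0 <= j t.
  move=> t0 tler; apply: Rintegral_ge0 => z _.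
  by rewrite mulr_ge0 ?nsq_ge0 ?shell_kernel_ge0.
have cj : cvg (j t @[t --> 0^'+]).
  apply: nonincreasing_at_right_is_cvgr.
    near=> e => s t; rewrite !in_itv/= => /andP[s0 se] /andP[t0 te] st.
    have er : e <= r by near: e; exact: nbhs_right_le.
    have sr := le_trans (ltW se) er; have ter := le_trans (ltW te) er.
    have [_ [js _]] := @shell_quadratic_integral s r 0 0 s0 sr.
    have [_ [jt _]] := @shell_quadratic_integral t r 0 0 t0 ter.
    apply: rV_le_integral => // z; rewrite ler_wpM2l ?nsq_ge0//.
    rewrite lerB// /far_kernel; case: ifP => [tz|_].
      by rewrite (le_trans st tz).
    by case: ifP => // _; rewrite invr_ge0 powR_ge0.
  near=> e; exists (near_const n sigma * r `^ (2 - 2 * sigma)) => _ [t /= + <-].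
  rewrite in_itv/= => /andP[t0 te]; apply: jle => //.
  rewrite (le_trans (ltW te))//; near: e; exact: nbhs_right_le.
exists (lim (j t @[t --> 0^'+])); split.
  apply/andP; split.
    by apply: limr_ge => //; near=> t; apply: jge; near: t;
      [exact: nbhs_right_gt|exact: nbhs_right_le].
  by apply: limr_le => //; near=> t; apply: jle; near: t;
    [exact: nbhs_right_gt|exact: nbhs_right_le].
apply: cvg_lim => //.
apply: (@cvg_trans _ ((a * j t + T) @[t --> 0^'+])).
  apply: near_eq_cvg; near=> t; apply/esym/trE; near: t;
    [exact: nbhs_right_gt|exact: nbhs_right_le].
by apply: cvgD; [exact: cvgMr|exact: cvg_cst].
Unshelve. all: by end_near. Qed.

End principal_value.

(** * Paraboloids as test functions *)

Section quadratic_test_functions.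
Context {R : realType} {n : nat}.
Implicit Types (x y c : 'rV[R]_n) (a b : R).

(** A paraboloid centred at [y]. Its partial derivatives belong to the same family with [a] = 0, so
    C2 regularity is C1 regularity used twice. *)
Definition quadratic y b c a x : R := b + (dotr c (x - y) + a * nsq (x - y)).

Lemma continuous_sum_rV (I : Type) (s : seq I) (F : I -> 'rV[R]_n -> R) :
  (forall i, continuous (F i)) -> continuous (fun x => \sum_(i <- s) F i x).
Proof.
move=> cF; elim: s => [|i s IH] x.
  rewrite (_ : (fun _ => _) = fun=> 0); first exact: cst_continuous.
  by apply/funext => y; rewrite big_nil.
rewrite (_ : (fun _ => _) = F i \+ (fun y => \sum_(j <- s) F j y)).
  by apply: continuousD; [exact: cF|exact: IH].
by apply/funext => y; rewrite big_cons.
Qed.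

Lemma dotr_continuous c : continuous (dotr c).
Proof.
apply: continuous_sum_rV => i x; apply: continuousM.
  exact: cst_continuous.
exact: coord_continuous.
Qed.

Lemma nsq_continuous : continuous (@nsq R n).
Proof.
apply: continuous_sum_rV => i x.
by apply: continuousM; exact: coord_continuous.
Qed.

Lemma quadratic_continuous y b c a : continuous (quadratic y b c a).
Proof.
move=> x; have shiftc : {for x, continuous (fun x : 'rV[R]_n => x - y)}.
  by apply: continuousB; [exact: cvg_id|exact: cst_continuous].
have cd : {for x, continuous (fun x => dotr c (x - y))}.
  by apply: (continuous_comp shiftc); exact: dotr_continuous.
have cn : {for x, continuous (fun x => a * nsq (x - y))}.
  apply: continuousM; first exact: cst_continuous.
  by apply: (continuous_comp shiftc); exact: nsq_continuous.
have cb : {for x, continuous (fun=> b : R)} by exact: cst_continuous.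
exact: (continuousD cb (continuousD cd cn)).
Qed.

Lemma dotr_delta (t : R) (i : 'I_n) x : dotr (t *: delta_mx ord0 i) x = t * x ord0 i.
Proof.
rewrite /dotr (bigD1 i)//= big1 ?addr0 => [|j ji].
  by rewrite !mxE !eqxx mulr1.
by rewrite !mxE eqxx (negbTE ji) mulr0 mul0r.
Qed.

Lemma dotrC c x : dotr c x = dotr x c.
Proof. by apply: eq_bigr => i _; rewrite mulrC. Qed.

Lemma dotrDr c x y : dotr c (x + y) = dotr c x + dotr c y.
Proof.
by rewrite /dotr -big_split/=; apply: eq_bigr => i _; rewrite mxE mulrDr.
Qed.

Lemma nsq_delta (t : R) (i : 'I_n) : nsq (t *: delta_mx ord0 i) = t ^+ 2.
Proof.
rewrite /nsq (bigD1 i)//= big1 ?addr0 => [|j ji].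
  by rewrite !mxE !eqxx mulr1.
by rewrite !mxE eqxx (negbTE ji) mulr0 expr0n.
Qed.

Lemma quadratic_quotient_cvg y b c a (i : 'I_n) x :
  (fun h : R => h^-1 *: (quadratic y b c a (h *: delta_mx ord0 i + x)
    - quadratic y b c a x)) @ 0^' -->
  quadratic y (c ord0 i) ((2 * a) *: delta_mx ord0 i) 0 x.
Proof.
(* For nonzero h the difference quotient is exactly [l + a * h]. *)
set l := quadratic y (c ord0 i) _ 0 x; apply: (@cvg_trans _ ((l + a * h) @[h --> 0^'])).
  apply: near_eq_cvg; near=> h.
  have h0 : h != 0 by near: h; exact: nbhs_dnbhs_neq.
  have Ew : h *: delta_mx ord0 i + x - y = h *: delta_mx ord0 i + (x - y).
    by rewrite addrA.
  rewrite /l /quadratic Ew; move: (x - y) => {Ew} w.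
  rewrite dotrDr nsqD (dotrC c (h *: _)) !dotr_delta nsq_delta /GRing.scale/=.
  by field.
have : (l + a * h) @[h --> (0 : R)^'] --> l + a * 0.
  apply: cvg_within_filter; apply: cvgD; first exact: cvg_cst.
  by apply: cvgMr; exact: cvg_id.
by rewrite mulr0 addr0.
Unshelve. all: by end_near. Qed.

Lemma C1_quadratic y b c a : C1 (quadratic y b c a) /\
  forall i, partial i (quadratic y b c a) =
    quadratic y (c ord0 i) ((2 * a) *: delta_mx ord0 i) 0.
Proof.
have pE i : partial i (quadratic y b c a) =
    quadratic y (c ord0 i) ((2 * a) *: delta_mx ord0 i) 0.
  apply/funext => x; apply/cvg_lim => //.
  exact: quadratic_quotient_cvg.
split=> //; split; first exact: quadratic_continuous.
move=> i; split; last by rewrite pE; exact: quadratic_continuous.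
by move=> x; apply/cvg_ex; eexists; exact: quadratic_quotient_cvg.
Qed.

Lemma C2_quadratic y b c a : C2 (quadratic y b c a).
Proof.
have [C1q pE] := C1_quadratic y b c a; split=> // i.
by rewrite pE; have [] := C1_quadratic y (c ord0 i) ((2 * a) *: delta_mx ord0 i) 0.
Qed.

Lemma dotr0 c : dotr c 0 = 0.
Proof. by rewrite /dotr big1// => i _; rewrite mxE mulr0. Qed.

Lemma nsq0 : nsq (0 : 'rV[R]_n) = 0.
Proof. by rewrite /nsq big1// => i _; rewrite mxE expr0n. Qed.

Lemma dotNr c x : dotr (- c) x = - dotr c x.
Proof. by rewrite dotrC dotrN dotrC. Qed.

Lemma paraboloid x b c a : exists phi : 'rV[R]_n -> R,
  C2 phi /\ forall z, phi (x + z) = b + (dotr c z + a * nsq z).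
Proof.
exists (quadratic x b c a); split; first exact: C2_quadratic.
by move=> z; rewrite /quadratic addrAC subrr add0r.
Qed.

End quadratic_test_functions.

(** * From the viscosity property to truncated integral inequalities *)

Section weak_solutions.
Context {R : realType} {n : nat}.
Variables (sigma : R) (Om : set 'rV[R]_n.+1).
Hypotheses (sigma01 : 0 < sigma < 1) (oOm : open Om).
Local Notation p := (n.+1%:R + 2 * sigma : R).
Local Notation mu := (lebesgue_rV n.+1 : {measure set 'rV[R]_n.+1 -> \bar R}).
Local Notation cap r := (near_const n sigma * r `^ (2 - 2 * sigma)).
Implicit Types (f u : 'rV[R]_n.+1 -> R) (x z c : 'rV[R]_n.+1).

(* What remains of the subsolution property after testing with a paraboloid
   touching from above: only the part of the singular integral away from the
   origin, up to the contribution of the paraboloid near the origin. *)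
Definition weak_subsolution f u := forall x c (a r : R),
  Om x -> 0 <= a -> 0 < r ->
  (forall z, u (x + z) - u x <= dotr c z + a * nsq z) ->
  - f x - 2 * (a * cap r) <=
    \int[mu]_z ((u (x + z) - u x) * far_kernel sigma r z).

Lemma measurable_increment u x : measurable_fun setT u ->
  measurable_fun setT (fun z => u (x + z) - u x).
Proof.
move=> mu_; apply: measurable_funB => //; apply: (measurableT_comp mu_).
exact: measurable_addl_rV.
Qed.

Lemma increment_bound u (U : R) x z :
  (forall y, `|u y| <= U) -> `|u (x + z) - u x| <= U + U.
Proof. by move=> uU; rewrite (le_trans (ler_normB _ _))// lerD. Qed.

(** On the shell between [r] and [s] the increment lies below the paraboloid, whose linear part
    cancels. This permits testing in a small ball inside the domain while the inequality is stated
    at a prescribed radius. *)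
Lemma far_integral_shrink u (U : R) x c (a r s : R) : measurable_fun setT u ->
  (forall y, `|u y| <= U) -> 0 <= a -> 0 < r -> r <= s ->
  (forall z, u (x + z) - u x <= dotr c z + a * nsq z) ->
  \int[mu]_z ((u (x + z) - u x) * far_kernel sigma r z) <=
  a * cap s + \int[mu]_z ((u (x + z) - u x) * far_kernel sigma s z).
Proof.
move=> mu_ uU a0 r0 rs uq; have s0 : 0 < s := lt_le_trans r0 rs.
have jM k : rV_integrable k -> rV_integrable (fun z => (u (x + z) - u x) * k z).
  apply: (rV_integrableM (B := U + U)); first exact: measurable_increment.
  by move=> z; exact: increment_bound.
have [jq [_ Eq]] := shell_quadratic_integral sigma01 c a r0 rs.
have jfs := jM _ (far_kernel_integrable sigma01 s0).
apply: (@le_trans _ _ (\int[mu]_z ((dotr c z + a * nsq z) * shell_kernel sigma r s z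
    + (u (x + z) - u x) * far_kernel sigma s z))).
  apply: rV_le_integral => [||z].
  - exact/jM/far_kernel_integrable.
  - exact: rV_integrableD.
  rewrite -lerBlDr -mulrBr -/(shell_kernel sigma r s z).
  by rewrite ler_wpM2r// shell_kernel_ge0.
rewrite rV_integralD// lerD2r Eq ler_wpM2l//.
exact: shell_moment_integral_le.
Qed.

Lemma eball_subset x (r : R) : Om x -> 0 < r ->
  exists2 s, 0 < s <= r & eball x s `<=` Om.
Proof.
move=> Omx r0; have /nbhs_ballP[e /= e0 eOm] : nbhs x Om by exact: open_nbhs_nbhs.
exists (Num.min e r); first by rewrite lt_min e0 r0 ge_min lexx orbT.
move=> y; rewrite /eball/= lt_min => /andP[xe _]; apply: eOm.
rewrite -ball_normE/= distrC; exact: le_lt_trans (norm_le_enorm _) xe.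
Qed.

Lemma norm_constK u x : norm_const n sigma * fractional_laplacian sigma u x =
  - pv_integral sigma u x.
Proof.
by rewrite /fractional_laplacian mulrA mulrN divff ?mulN1r// gt_eqF// norm_const_gt0.
Qed.

Lemma cap_le (r s : R) : 0 < r -> r <= s -> cap r <= cap s.
Proof.
move=> r0 rs; have /andP[_ s1] := sigma01.
apply: ler_wpM2l; first by apply: ltW; exact: near_const_gt0.
by rewrite ge0_ler_powR ?nnegrE ?(ltW r0)//; [lra|exact: le_trans (ltW r0) rs].
Qed.

Lemma visc_subsolution_weak f u (U : R) : measurable_fun setT u ->
  (forall y, `|u y| <= U) -> visc_subsolution sigma Om f u ->
  weak_subsolution f u.
Proof.
move=> mu_ uU vu x c a r Omx a0 r0 uq.
have [s /andP[s0 sr] sOm] := eball_subset Omx r0.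
have [phi [Cphi phiE]] := paraboloid x (u x) c a.
have phix : phi x = u x by rewrite -[in LHS](addr0 x) phiE dotr0 nsq0 mulr0 !addr0.
have ub y : eball x s y -> u y <= phi y.
  by move=> _; rewrite -(subrKC x y) phiE -lerBlDl.
have := vu x s phi s0 sOm Cphi phix ub; rewrite norm_constK.
have phiE' z : phi (x + z) = phi x + (dotr c z + a * nsq z) by rewrite phiE phix.
have [J [/andP[J0 Jle] ->]] := pv_integral_patch sigma01 mu_ uU s0 phiE' phix.
have := far_integral_shrink mu_ uU a0 s0 sr uq.
(* One [a * cap r] pays for the paraboloid on the ball of radius [s], the other for moving the
   truncation from [s] to [r]. *)
have : a * J <= a * cap r by rewrite ler_wpM2l// (le_trans Jle)// cap_le.
by lra.
Qed.

(** Written for -u and -f so that a single one-sided comparison serves both signs. The test function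
    is the opposite paraboloid, touching [u] from below. *)
Lemma visc_supersolution_weak f u (U : R) : measurable_fun setT u ->
  (forall y, `|u y| <= U) -> visc_supersolution sigma Om f u ->
  weak_subsolution (\- f) (\- u).
Proof.
move=> mu_ uU vu x c a r Omx a0 r0 uq.
have [s /andP[s0 sr] sOm] := eball_subset Omx r0.
have [phi [Cphi phiE]] := paraboloid x (u x) (- c) (- a).
have phix : phi x = u x by rewrite -[in LHS](addr0 x) phiE dotr0 nsq0 mulr0 !addr0.
have lb y : eball x s y -> phi y <= u y.
  move=> _; rewrite -(subrKC x y) phiE dotNr; have := uq (y - x) => /=.
  by rewrite subrKC; lra.
have := vu x s phi s0 sOm Cphi phix lb; rewrite norm_constK.
have phiE' z : phi (x + z) = phi x + (dotr (- c) z + - a * nsq z).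
  by rewrite phiE phix.
have [J [/andP[J0 Jle] ->]] := pv_integral_patch sigma01 mu_ uU s0 phiE' phix.
have NuU y : `|(\- u) y| <= U by rewrite normrN.
have := far_integral_shrink (measurable_funN mu_) NuU a0 s0 sr uq.
rewrite (_ : \int[mu]_z (((\- u) (x + z) - (\- u) x) * far_kernel sigma s z) =
  - \int[mu]_z ((u (x + z) - u x) * far_kernel sigma s z)); last first.
  rewrite -[RHS]mulN1r -rV_integralZ.
    by apply: rV_eq_integral => z /=; ring.
  apply: (rV_integrableM (B := U + U)); first exact: measurable_increment.
    by move=> z; exact: increment_bound.
  exact: far_kernel_integrable.
have : a * J <= a * cap r by rewrite ler_wpM2l// (le_trans Jle)// cap_le.
by rewrite /=; lra.
Qed.

End weak_solutions.

(** * Exterior cubes *)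

Section local_lipschitz.
Context {R : realType} {n : nat}.
Implicit Types (x y h : 'rV[R]_n) (g : 'rV[R]_n -> R).

Lemma partial_increment_le g (i : 'I_n) h (t M : R) :
  (forall s : R, (0 <= s <= t) || (t <= s <= 0) ->
    derivable g (h + s *: delta_mx ord0 i) (delta_mx ord0 i) /\
    `|partial i g (h + s *: delta_mx ord0 i)| <= M) ->
  `|g (h + t *: delta_mx ord0 i) - g h| <= M * `|t|.
Proof.
move=> dM; set e := delta_mx ord0 i in dM *.
pose phi (s : R) := g (h + s *: e).
have quotE (s : R) : (fun u : R => u^-1 *: (phi (u *: 1 + s) - phi s)) =
    (fun u : R => u^-1 *: (g (u *: e + (h + s *: e)) - g (h + s *: e))).
  apply/funext => u; rewrite /phi; congr (_ *: (g _ - _)).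
  by rewrite addrCA scalerDl [u *: 1]mulr1.
have dphi (s : R) : (0 <= s <= t) || (t <= s <= 0) -> is_derive s 1 phi (partial i g (h + s *: e)).
  move=> /dM[dg _]; apply: DeriveDef; first by rewrite /derivable quotE.
  by rewrite /partial /derive quotE.
have cphi (a b : R) : (forall s : R, s \in `[a, b] -> (0 <= s <= t) || (t <= s <= 0)) ->
    {within `[a, b], continuous phi}.
  move=> ab; apply: derivable_within_continuous => s /ab /dphi.
  by case.
have phi0 : phi 0 = g h by rewrite /phi scale0r addr0.
have [t0|/ltW t0] := leP 0 t.
  have inab (s : R) : s \in `[0, t] -> (0 <= s <= t) || (t <= s <= 0).
    by rewrite in_itv/= => ->.
  have [c ct E] := MVT_segment t0
    (fun s st => dphi s (inab s (subset_itv_oo_cc st))) (cphi _ _ inab).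
  rewrite -phi0 -/(phi t) E subr0 normrM ler_wpM2r//.
  by have [] := dM c (inab c ct).
have inab (s : R) : s \in `[t, 0] -> (0 <= s <= t) || (t <= s <= 0).
  by rewrite in_itv/= => ->; rewrite orbT.
have [c ct E] := MVT_segment t0
  (fun s st => dphi s (inab s (subset_itv_oo_cc st))) (cphi _ _ inab).
rewrite -phi0 -/(phi t) distrC E sub0r normrM normrN ler_wpM2r//.
by have [] := dM c (inab c ct).
Qed.

(** Passage from [x] to [y] one coordinate at a time: a sup-norm ball is a box, so the intermediate
    segments stay in it, where the partial derivatives are bounded by continuity. *)
Lemma C1_locally_lipschitz g x0 : C1 g -> exists (L e : R),
  [/\ 0 <= L, 0 < e & forall x y, ball x0 e x -> ball x0 e y ->
    `|g x - g y| <= L * `|x - y|].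
Proof.
move=> [_ C1g].
pose M := \sum_(i < n) (`|partial i g x0| + 1).
have [e e0 eM] : exists2 e : R, 0 < e & forall i x, ball x0 e x -> `|partial i g x| <= M.
  have : \forall x \near x0, forall i, `|partial i g x| <= M.
    apply: (@filter_forall _ _ (fun i => [set x | `|partial i g x| <= M]) (nbhs x0) _) => i.
    have [_ /(_ x0)] := C1g i.
    move=> /cvgrPdist_lt/(_ 1 ltr01); apply: filterS => x pxi.
    apply: (@le_trans _ _ (`|partial i g x0| + 1)).
      rewrite -[in leLHS](subrK (partial i g x0) (partial i g x)) addrC.
      by rewrite (le_trans (ler_normD _ _))// lerD2l distrC ltW.
    by rewrite /M (bigD1 i)//= lerDl sumr_ge0.
  by move=> /nbhs_ballP[e /= e0 eM]; exists e => // i x /eM; exact.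
exists (n%:R * M), e; split=> //.
  by rewrite mulr_ge0// sumr_ge0.
move=> x y xe ye.
pose h k : 'rV[R]_n := \row_j (if (j < k)%N then y ord0 j else x ord0 j).
have h0 : h 0%N = x by apply/rowP => j; rewrite mxE.
have hn : h n = y by apply/rowP => j; rewrite mxE ltn_ord.
have hS (i : 'I_n) : h i.+1 = h i + (y ord0 i - x ord0 i) *: delta_mx ord0 i.
  apply/rowP => j; rewrite !mxE eqxx /= ltnS leq_eqVlt.
  have [->|ji] := eqVneq j i; first by rewrite eqxx ltnn mulr1 subrKC.
  by rewrite -[(j : nat) == i]/(j == i) (negbTE ji)/= mulr0 addr0.
rewrite distrC -h0 -hn -(telescope_sumr (g \o h))// big_mkord.
rewrite (le_trans (ler_norm_sum _ _ _))//.
apply: (@le_trans _ _ (\sum_(i < n) M * `|h 0%N - h n|)); last first.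
  by rewrite sumr_const card_ord -[(_ * _) *+ n]mulr_natl mulrA.
apply: ler_sum => i _; rewrite /= hS.
set t := y ord0 i - x ord0 i.
have tle : `|t| <= `|h 0%N - h n|.
  by have := coord_le_norm (y - x) i; rewrite h0 hn [leRHS]distrC !mxE.
have M0 : 0 <= M by rewrite sumr_ge0.
apply: (@le_trans _ _ (M * `|t|)); last by rewrite ler_wpM2l.
apply: partial_increment_le => s st; split; first by have [dg _] := C1g i; exact: dg.
apply: eM; split => // i' j; rewrite ord1 !mxE eqxx/=.
have xj := xe.2 ord0 j; have yj := ye.2 ord0 j.
have [ji|ji] := eqVneq j i; last first.
  by rewrite mulr0 addr0; case: ifP.
move: xj yj; rewrite /ball/= !ltr_distl ji ltnn mulr1 => /andP[x1 x2] /andP[y1 y2].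
by case/orP: st => /andP[]; rewrite /t => ? ?; apply/andP; split; lra.
Qed.

End local_lipschitz.

(** * Uniformity from compactness *)

Section uniformity.
Context {R : realType} {n : nat}.
Implicit Types (x y z : 'rV[R]_n) (K D : set 'rV[R]_n).

(** Compactness in its near-covering form, for the filter of small positive parameters; monotonicity
    lets a local parameter be replaced by any smaller one. *)
Lemma compact_uniform (K : set 'rV[R]_n) (P : R -> 'rV[R]_n -> Prop) :
  compact K -> (forall c d x, 0 < c <= d -> P d x -> P c x) ->
  (forall x, K x -> exists2 d : R, 0 < d & forall y, K y -> ball x d y -> P d y) ->
  exists2 c : R, 0 < c & forall x, K x -> P c x.
Proof.
move=> /compact_near_coveringP/near_covering_withinP cK Pmono Ploc.
have : \forall c \near (0 : R)^'+, K `<=` P c.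
  apply: cK => x Kx; have [d d0 dP] := Ploc x Kx.
  exists (ball x d, [set c : R | 0 < c <= d]).
    split; first exact: nbhsx_ballx.
    near=> c; apply/andP; split; near: c; first exact: nbhs_right_gt.
    exact: nbhs_right_le.
  by move=> [y c] [/= xy cd] Ky; apply: (Pmono c d) => //; exact: dP.
move=> H; near (0 : R)^'+ => c; exists c => [|x Kx].
  by near: c; exact: nbhs_right_gt.
by apply: (near H c).
Unshelve. all: by end_near. Qed.

(** The Heine-Cantor theorem with only one of the two points confined to the compact set: [u] on the
    closure of the domain is compared with its values on the whole space. *)
Lemma compact_uniformly_continuous K D (g : 'rV[R]_n -> R) : compact K ->
  (forall x, K x -> forall e : R, 0 < e -> exists2 d : R, 0 < d &
    forall y, D y -> `|x - y| < d -> `|g x - g y| < e) ->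
  K `<=` D ->
  forall e : R, 0 < e -> exists2 d : R, 0 < d &
    forall x y, K x -> D y -> `|x - y| < d -> `|g x - g y| < e.
Proof.
move=> cK cg KD e e0.
have [||d d0 dP] := @compact_uniform K
  (fun d x => forall y, D y -> `|x - y| < d -> `|g x - g y| < e) cK; last first.
- by exists d => // x y Kx; exact: dP.
- move=> x Kx; have [d d0 dP] := cg x Kx (e / 2) (divr_gt0 e0 (ltr0Sn _ _)).
  exists (d / 2) => [|y Ky xy z Dz yz]; first by rewrite divr_gt0.
  have xy' : `|x - y| < d / 2 by rewrite -ball_normE in xy.
  have gxy : `|g x - g y| < e / 2.
    by apply: dP; [exact: KD|rewrite (lt_trans xy')// gtr_pMr// invf_lt1// ltr1n].
  have gxz : `|g x - g z| < e / 2.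
    apply: dP => //; rewrite (le_lt_trans (ler_distD y _ _))//.
    by rewrite [ltRHS]splitr ltrD.
  by rewrite (le_lt_trans (ler_distD (g x) _ _))// [ltRHS]splitr distrC ltrD.
by move=> c d x /andP[c0 cd] H y Dy xy; apply: H => //; exact: lt_le_trans cd.
Qed.

End uniformity.

Section exterior.
Context {R : realType} {n : nat}.
Implicit Types (Om : set 'rV[R]_n.+1) (x y z : 'rV[R]_n.+1).

Lemma compact_closure_bounded Om : bounded_set Om -> compact (closure Om).
Proof.
move=> [M [Mreal bM]]; apply: bounded_closed_compact; last exact: closed_closure.
exists (M + 1); split; first by rewrite realD.
move=> r Mr x clx.
have r0 : 0 < r - (M + 1) by rewrite subr_gt0.
have [y [Omy xy]] := clx (ball x (r - (M + 1))) (nbhsx_ballx x _ r0).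
have My : `|y| <= M + 1 by apply: bM; rewrite // ltrDl.
rewrite -ball_normE/= in xy; rewrite /= -[x](subrK y).
by rewrite (le_trans (ler_normD _ _))// -lerBrDr (le_trans (ltW xy))// lerB.
Qed.

(* The complement of the domain has positive density at every scale, uniformly:
   near the domain, each of its points sees a cube of comparable size. *)
Definition exterior_cubes Om (c : R) := forall x y (s : R), ~ Om x -> Om y ->
  `|x - y| < c -> 0 < s < c -> exists a : 'I_n.+1 -> R,
    forall z, (forall i, a i < z ord0 i <= a i + c * s) ->
      ~ Om (x + z) /\ enorm z <= s.

(** Near a boundary point the complement lies on and below the graph of an L-Lipschitz function. A
    move of at most [d] in the other coordinates and of at least [L * d] down the axis does not
    leave it. Near a point of [Om] there is no [x] to consider. *)
Lemma exterior_cubes_locally Om : open Om -> C2_boundary Om ->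
  forall y, closure Om y -> exists2 c : R, 0 < c &
  forall y', closure Om y' -> ball y c y' ->
  forall x (s : R), ~ Om x -> `|x - y'| < c -> 0 < s < c ->
  exists a : 'I_n.+1 -> R, forall z,
    (forall i, a i < z ord0 i <= a i + c * s) -> ~ Om (x + z) /\ enorm z <= s.
Proof.
move=> oOm bdOm.
move=> y clOmy; have [Omy|nOmy] := pselect (Om y).
  have /nbhs_ballP[e /= e0 eOm] : nbhs y Om by exact: open_nbhs_nbhs.
  exists (e / 2) => [|y' _ yy' x s nOmx xy' _]; first by rewrite divr_gt0.
  exfalso; apply: nOmx; apply: eOm; apply: (ball_split yy').
  by rewrite -ball_normE/= distrC.
have [|i [b [g [[C1g _]]]]] := bdOm y.
  by split => // /interior_subset.
move=> /nbhs_ballP[e /= e0 eP].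
have [L [e' [L0 e'0 gL]]] := C1_locally_lipschitz (col' i y) C1g.
pose rho := Num.min e e'.
have rho0 : 0 < rho by rewrite lt_min e0.
(* [c * q <= 1] keeps the cube within distance [s] of the origin; [c <= rho / 4] keeps [x] and
   [x + z] where the graph and the Lipschitz bound are available. *)
pose q : R := n.+1%:R * (L + 1).
have q0 : 0 < q by rewrite mulr_gt0// ltr_wpDl.
pose c := Num.min (rho / 4) q^-1.
have c0 : 0 < c by rewrite lt_min divr_gt0// invr_gt0.
have crho : c <= rho / 4 by rewrite ge_min lexx.
have cq : c * q <= 1.
  by rewrite -ler_pdivlMr// div1r ge_min lexx orbT.
exists c => // y' _ yy' x s nOmx xy' /andP[s0 sc].
have yx : `|y - x| < rho / 2.
  rewrite -ball_normE in yy'; rewrite (le_lt_trans (ler_distD y' _ _))//.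
  by move: yy' xy'; rewrite /= [`|x - y'|]distrC => ? ?; lra.
pose d := c * s.
have d0 : 0 < d by rewrite mulr_gt0.
(* Along the [i]-th axis the cube lies at depth between [L * d] and [(L + 1) * d], on the side given
   by the orientation [b]. *)
exists (fun j => if j == i then (if b then L * d else - ((L + 1) * d)) else 0) => z.
rewrite -/d => zd.
have zother j : j != i -> 0 < z ord0 j <= d.
  by move=> ji; have := zd j; rewrite (negbTE ji) add0r.
have zi : (-1) ^+ b * z ord0 i <= - (L * d).
  have := zd i; rewrite eqxx; case: (b) => /andP[z1 z2].
    by rewrite expr1; lra.
  by rewrite expr0; lra.
have zbound j : `|z ord0 j| <= (L + 1) * d.
  have Ld : 0 <= L * d by rewrite mulr_ge0// ltW.
  have := zd j; rewrite ler_norml; case: (j == i) => [|/andP[z1 z2]].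
    by case: (b) => /andP[z1 z2]; apply/andP; split; lra.
  by apply/andP; split; lra.
have zs : enorm z <= s.
  rewrite (le_trans (enorm_le_coord _ zbound))//.
    by rewrite mulr_ge0 ?addr_ge0// ltW.
  rewrite mulrA -/q /d mulrA -[leRHS]mul1r ler_wpM2r ?(ltW s0)//.
  by rewrite mulrC.
split=> //.
have yxz : `|y - (x + z)| < rho.
  rewrite opprD addrA (le_lt_trans (ler_normB _ _))//.
  have := norm_le_enorm z; move: crho sc; lra.
have inball w : `|y - w| < rho -> ball y e w /\ ball (col' i y) e' (col' i w).
  rewrite /rho lt_min => /andP[we we']; split; first by rewrite -ball_normE.
  split => // i' j; rewrite !mxE ord1 /ball/=.
  rewrite (le_lt_trans _ we')//; have := coord_le_norm (y - w) (lift i j).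
  by rewrite !mxE.
have yx' : `|y - x| < rho by move: yx; lra.
have [xe xe'] := inball _ yx'; have [xze xze'] := inball _ yxz.
have := eP _ xe; have := eP _ xze; rewrite /= => -> Ex.
apply/negP; rewrite -leNgt.
have gx : (-1) ^+ b * x ord0 i <= g (col' i x).
  by rewrite leNgt; apply/negP => /Ex.
have := gL _ _ xe' xze'; rewrite ler_norml => /andP[_ gle].
have : `|col' i x - col' i (x + z)| <= d.
  rewrite [leLHS]/Num.norm/= mx_normrE; apply/bigmax_leP; split; first exact: ltW.
  move=> [i' j] _ /=; rewrite ord1 !mxE opprD addrA subrr add0r normrN.
  have ji : lift i j != i by rewrite eq_sym neq_lift.
  by have /andP[z1 z2] := zother _ ji; rewrite ger0_norm// ltW.
move=> /(ler_wpM2l L0) Ld; move: zi; rewrite !mxE mulrDr; lra.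
Qed.

(** A smaller [c] gives smaller cubes with the same corner, so compactness of the closure makes the
    local constant uniform. *)
Lemma exterior_cubes_C2 Om : open Om -> bounded_set Om -> C2_boundary Om ->
  exists2 c, 0 < c & exterior_cubes Om c.
Proof.
move=> oOm bOm bdOm.
have [||c c0 cP] := @compact_uniform R n.+1 (closure Om) (fun c y =>
  forall x (s : R), ~ Om x -> `|x - y| < c -> 0 < s < c ->
  exists a : 'I_n.+1 -> R, forall z,
    (forall i, a i < z ord0 i <= a i + c * s) -> ~ Om (x + z) /\ enorm z <= s)
  (compact_closure_bounded bOm); last first.
- exists c => // x y s Omx Omy xy sc; apply: (cP y) => //.
  exact: subset_closure.
- exact: exterior_cubes_locally.
move=> c d y /andP[c0 cd] Pd x s Omx xy /andP[s0 sc].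
have [|a aP] := Pd x s Omx (lt_le_trans xy cd); first by rewrite s0 (lt_le_trans sc).
exists a => z za; apply: aP => i; have /andP[-> zi] := za i => /=.
by rewrite (le_trans zi)// lerD2l ler_wpM2r// ltW.
Qed.

End exterior.

Section domain_functions.
Context {R : realType} {n : nat}.
Implicit Types (Om K : set 'rV[R]_n) (x y : 'rV[R]_n) (g u : 'rV[R]_n -> R).

Lemma within_continuousE K g : {within K, continuous g} -> forall x, K x ->
  forall e : R, 0 < e -> exists2 d : R, 0 < d &
    forall y, K y -> `|x - y| < d -> `|g x - g y| < e.
Proof.
move=> /subspace_continuousP cg x Kx e e0.
have /cvgrPdist_lt/(_ e e0) := cg x Kx.
move=> /nbhs_ballP[d /= d0 dP]; exists d => // y Ky xy; apply: dP => //.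
by rewrite -ball_normE.
Qed.

Lemma within_continuous_bounded K g : compact K -> K !=set0 ->
  {within K, continuous g} -> exists B : R, forall x, K x -> `|g x| <= B.
Proof.
move=> cK K0 cg.
have cng : {within K, continuous (fun x => `|g x|)}.
  apply/subspace_continuousP => x Kx; apply: cvg_norm.
  by move/subspace_continuousP : cg; exact.
have [c _ cP] := EVT_max_rV K0 cK cng; exists `|g c| => x Kx.
by apply: cP; rewrite inE.
Qed.

(** Boundary points lie outside the open set [Om], so [u] is 0 there, which matches its values off
    the closure. *)
Lemma zero_extension_continuous Om u : open Om ->
  {within closure Om, continuous u} -> (forall x, ~ Om x -> u x = 0) ->
  forall x (e : R), 0 < e ->
  exists2 d : R, 0 < d & forall y, `|x - y| < d -> `|u x - u y| < e.
Proof.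
move=> oOm /within_continuousE cu u0 x e e0.
have [clx|nclx] := pselect (closure Om x).
  have [d d0 dP] := cu x clx e e0; have [Omx|nOmx] := pselect (Om x).
    have /nbhs_ballP[r /= r0 rP] : nbhs x Om by exact: open_nbhs_nbhs.
    exists (Num.min d r); first by rewrite lt_min d0.
    move=> y; rewrite lt_min => /andP[xd xr]; apply: dP => //.
    by apply: subset_closure; apply: rP; rewrite -ball_normE.
  exists d => // y xy; have [cly|ncly] := pselect (closure Om y); first exact: dP.
  by rewrite !u0 ?subrr ?normr0// => Omy; apply: ncly; exact: subset_closure.
have /nbhs_ballP[r /= r0 rP] : nbhs x (~` closure Om).
  by apply: open_nbhs_nbhs; split => //; exact/closed_openC/closed_closure.
exists r => // y xy; rewrite !u0 ?subrr ?normr0// => Omy.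
  have : ball x r y by rewrite -ball_normE.
  by move=> /rP; apply; exact: subset_closure.
by apply: nclx; exact: subset_closure.
Qed.

End domain_functions.

(** * The two estimates *)

Section estimates.
Context {R : realType} {n : nat}.
Variables (sigma eps : R).
Hypotheses (sigma01 : 0 < sigma < 1) (eps0 : 0 < eps).
Local Notation p := (n.+1%:R + 2 * sigma : R).
Local Notation mu := (lebesgue_rV n.+1 : {measure set 'rV[R]_n.+1 -> \bar R}).
Local Notation cap r := (near_const n sigma * r `^ (2 - 2 * sigma)).
Local Notation tail r := (far_const n sigma * r `^ (- (2 * sigma))).
Local Notation K := (@kernel_eps R n sigma eps).
Local Notation mass := (\int[mu]_z K z).
Implicit Types (x y z : 'rV[R]_n.+1) (u v w : 'rV[R]_n.+1 -> R) (r : R).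

Definition near_kernel_eps r z : R := if enorm z < r then K z else 0.

Lemma near_kernel_eps_ge0 r z : 0 <= near_kernel_eps r z.
Proof. by rewrite /near_kernel_eps; case: ifP => // _; exact: kernel_eps_ge0. Qed.

Lemma near_kernel_eps_integrable r : rV_integrable (near_kernel_eps r).
Proof.
apply: (le_integrable_fin (g := K)); last first.
  exact: @kernel_eps_integrable R n sigma sigma01 eps eps0.
  move=> z; rewrite ger0_norm ?near_kernel_eps_ge0// /near_kernel_eps.
  by case: ifP => // _; exact: kernel_eps_ge0.
apply: measurable_fun_ifT => //; last exact: measurable_kernel_eps.
by apply: (measurable_fun_bool true); rewrite setTI; exact: measurable_enorm_lt.
Qed.

Lemma near_quadratic_integral r (c : 'rV[R]_n.+1) (a : R) : 0 < r ->
  rV_integrable (fun z => (dotr c z + a * nsq z) * near_kernel_eps r z) /\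
  exists2 J : R, 0 <= J <= cap r &
  \int[mu]_z ((dotr c z + a * nsq z) * near_kernel_eps r z) = a * J.
Proof.
move=> r0; have [||||jq [jn E]] := @quadratic_integral R n.+1 (near_kernel_eps r) r c a.
- exact: ltW.
- exact: near_kernel_eps_integrable.
- by move=> z; rewrite /near_kernel_eps enormN kernel_epsN.
- by move=> z rz; rewrite /near_kernel_eps ltNge (ltW rz).
split=> //; exists (\int[mu]_z (nsq z * near_kernel_eps r z)) => //.
have [jm mle] := @near_moment_integral R n sigma sigma01 r r0.
apply/andP; split.
  by apply: Rintegral_ge0 => z _; rewrite mulr_ge0 ?nsq_ge0 ?near_kernel_eps_ge0.
apply: le_trans mle; apply: rV_le_integral => // z.
rewrite /near_kernel_eps /near_moment; case: ifP => _; last by rewrite mulr0.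
by apply: nsq_kernel_eps_le => //; exact: ltW.
Qed.

Lemma increment_integrable v (B : R) x : measurable_fun setT v ->
  (forall y, `|v y| <= B) -> rV_integrable (fun z => (v (x + z) - v x) * K z).
Proof.
move=> mv vB; apply: (rV_integrableM (B := B + B)).
- exact: measurable_increment.
- by move=> z; exact: increment_bound.
exact: kernel_eps_integrable.
Qed.

Definition far_box (r : R) : set 'rV[R]_n.+1 :=
  [set z | forall i, r < z ord0 i <= r + 1].

(** A lower bound for [K] on [far_box r], uniform in eps <= 1: points of that cube have norm at most
    N(r+1). *)
Definition box_weight (r : R) : R := (1 + (n.+1%:R * (r + 1)) `^ p)^-1.

Lemma box_weight_gt0 r : 0 < box_weight r.
Proof. by rewrite invr_gt0 ltr_pwDl ?powR_ge0. Qed.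

Lemma far_box_enorm r z : 0 < r -> far_box r z ->
  r < enorm z <= n.+1%:R * (r + 1).
Proof.
move=> r0 bz; apply/andP; split.
  have /andP[z0 _] := bz ord0; apply: lt_le_trans (coord_le_enorm z ord0).
  by rewrite (lt_le_trans z0)// ler_norm.
apply: enorm_le_coord => [|i]; first by rewrite addr_ge0// ltW.
by have /andP[z0 z1] := bz i; rewrite ger0_norm// ltW// (lt_trans r0).
Qed.

Lemma far_box_kernel r z : 0 < r -> eps <= 1 -> far_box r z -> box_weight r <= K z.
Proof.
move=> r0 e1 /(far_box_enorm r0)/andP[_ zr]; apply: le_trans (kernel_eps_ge sigma01 eps0 zr).
rewrite lef_pV2 ?posrE ?ltr_pwDl ?powR_ge0 ?powR_gt0// lerD2r.
have := @ge0_ler_powR R p (ltW (kernel_exponent_gt0 sigma01)) eps 1.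
by rewrite powR1; apply => //; rewrite nnegrE ltW.
Qed.

(* [x] and [y] are the two points of the doubling argument.  Splitting at
   radius [r], the increments of [v] near [y] are bounded below by the
   paraboloid, those away from [y] by the increments of [u] at [x]; on the far
   box both functions vanish, and the gap [M] is gained. *)
Lemma interior_estimate (Om : set 'rV[R]_n.+1) f u v (U B Rb : R) x y c
    (a kappa M r : R) :
  measurable_fun setT u -> (forall y, `|u y| <= U) ->
  measurable_fun setT v -> (forall y, `|v y| <= B) ->
  (forall x, ~ Om x -> u x = 0) -> (forall x, ~ Om x -> v x = 0) ->
  (forall x z, Om x -> Rb < enorm z -> ~ Om (x + z)) ->
  weak_subsolution sigma Om f u -> nonlocal_eps sigma eps v y = - f y ->
  eps <= 1 -> 0 <= a -> 0 <= kappa -> 0 <= M -> 0 < r -> r <= Rb ->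
  Om x -> Om y ->
  (forall z, u (x + z) - u x <= dotr c z + a * nsq z) ->
  (forall z, dotr c z - a * nsq z - kappa <= v (y + z) - v y) ->
  (forall z, u (x + z) - u x <= v (y + z) - v y + kappa) ->
  M <= u x - v y + kappa ->
  M * box_weight Rb <= f x - f y + 3 * (a * cap r)
    + 2 * U * (eps / r) `^ p * tail r + kappa * mass.
Proof.
move=> mu_ uU mv vB u0 v0 bdd weaku eqv e1 a0 k0 M0 r0 rRb Omx Omy H1 H2 H3 H4.
have Rb0 : 0 < Rb := lt_le_trans r0 rRb.
have U0 : 0 <= U := le_trans (normr_ge0 _) (uU x).
set P := (eps / r) `^ p.
have P0 : 0 <= P := powR_ge0 _ _.
have jv := increment_integrable y mv vB.
have [jq [J /andP[J0 Jle] Eq]] := near_quadratic_integral c (- a) r0.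
have [jf fle] := @far_kernel_integral R n sigma sigma01 r r0.
have ju : rV_integrable (fun z => (u (x + z) - u x) * far_kernel sigma r z).
  apply: (rV_integrableM (B := U + U)) => //; first exact: measurable_increment.
  by move=> z; exact: increment_bound.
have [jb Eb] := @rV_integral_box R n.+1 (fun=> Rb) 1 ler01.
have jK := @kernel_eps_integrable R n sigma sigma01 eps eps0.
have T_ge := weaku x c a r Omx a0 r0 H1.
set T := \int[mu]_z _ in T_ge.
(* These functions add up to a minorant of the integrand for [v] at [y]: the concave paraboloid
   inside radius [r], the increments of [u] outside, the losses from exchanging the kernels and from
   [kappa], and the gain on the box. *)
have jL1 := rV_integrableD jq ju.
have jL2 := rV_integrableD (rV_integrableZ (- (2 * U * P)) jf) (rV_integrableZ (- kappa) jK).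
have jL3 := rV_integrableZ (M * box_weight Rb) jb.
have jL := rV_integrableD (rV_integrableD jL1 jL2) jL3.
have := rV_le_integral jL jv; rewrite -/(nonlocal_eps sigma eps v y) eqv.
rewrite !rV_integralD//; try by [exact: rV_integrableZ|exact: rV_integrableD].
rewrite !rV_integralZ// Eq Eb expr1n mulr1 -/T => H.
have {}H : - a * J + T + (- (2 * U * P) * \int[mu]_z far_kernel sigma r z
    + - kappa * mass) + M * box_weight Rb <= - f y.
  apply: H => z; rewrite indicE /near_kernel_eps.
  have K0 := @kernel_eps_ge0 R n sigma eps z.
  have [zr|rz] := ltP (enorm z) r.
    rewrite memNset/=; last first.
      move=> /(far_box_enorm Rb0)/andP[+ _].
      by rewrite ltNge (le_trans (ltW zr)).
    rewrite /far_kernel [r <= enorm z]leNgt zr/= !mulr0 !addr0 add0r.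
    have := H2 z; move: K0; set k := kernel_eps _ _ _; set V := v _ - v _.
    by rewrite mulNr -mulrDl => kk0 HH; rewrite ler_wpM2r//; lra.
  rewrite mulr0 add0r.
  have Dk : `|far_kernel sigma r z - K z| <= P * far_kernel sigma r z.
    exact: far_kernel_sub_eps.
  set D := u (x + z) - u x in H1 H3 *; set V := v (y + z) - v y.
  have DU : `|D| <= 2 * U by rewrite mulrDl mul1r; exact: increment_bound.
  have DKf : D * (far_kernel sigma r z - K z) <= 2 * U * (P * far_kernel sigma r z).
    by rewrite (le_trans (ler_norm _))// normrM ler_pM.
  have H3z : D <= V + kappa by exact: H3.
  case: (boolP (z \in _)) => [|_] /=.
    rewrite inE => bz; have Kz := far_box_kernel Rb0 e1 bz.
    have /andP[Rbz _] := far_box_enorm Rb0 bz.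
    have DE : D = - u x by rewrite /D u0 ?sub0r//; exact: bdd.
    have VE : V = - v y by rewrite /V v0 ?sub0r//; exact: bdd.
    (* On the box V - D = u x - v y, which is at least M - kappa. *)
    have : M * box_weight Rb <= M * K z by rewrite ler_wpM2l.
    have : 0 <= (V - D + kappa - M) * K z.
      by rewrite mulr_ge0// DE VE; lra.
    rewrite mulr1; nra.
  have : 0 <= (V + kappa - D) * K z by rewrite mulr_ge0// subr_ge0.
  by rewrite mulr0 addr0; nra.
(* The third [a * cap r]; the other two come from [T_ge]. *)
have : a * J <= a * cap r by rewrite ler_wpM2l.
have : 2 * U * P * \int[mu]_z far_kernel sigma r z <= 2 * U * P * tail r.
  by rewrite ler_wpM2l// !mulr_ge0.
by lra.
Qed.

(* The gap [G] is gained on the cube with corner [E], to be taken in the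
   complement of the domain. *)
Lemma boundary_estimate w f (B : R) y (E : 'I_n.+1 -> R) (l : R) c
    (a kappa G r d e1 e2 : R) :
  measurable_fun setT w -> (forall y, `|w y| <= B) ->
  nonlocal_eps sigma eps w y = f -> 0 <= l -> 0 <= a ->
  0 <= kappa -> 0 <= G -> 0 < r -> 0 < d -> 0 <= e1 -> 0 <= e2 ->
  (forall z, w (y + z) - w y <= dotr c z + a * nsq z + kappa) ->
  (forall z, (forall i, E i < z ord0 i <= E i + l) -> enorm z < r /\
    w (y + z) - w y <= dotr c z + a * nsq z + kappa - G) ->
  (forall z, enorm z < d -> w (y + z) - w y <= e1) ->
  (forall z, w (y + z) - w y <= e2) ->
  f <= a * cap r + kappa * mass - G * (eps `^ p + r `^ p)^-1 * l ^+ n.+1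
    + e1 * tail r + e2 * tail d.
Proof.
move=> mw wB eqw l0 a0 k0 G0 r0 d0 e10 e20 H1 H2 H3 H4.
have jw := increment_integrable y mw wB.
have [jq [J /andP[J0 Jle] Eq]] := near_quadratic_integral c a r0.
have [jr rle] := @far_kernel_integral R n sigma sigma01 r r0.
have [jd dle] := @far_kernel_integral R n sigma sigma01 d d0.
have [jb Eb] := @rV_integral_box R n.+1 E l l0.
have jK := @kernel_eps_integrable R n sigma sigma01 eps eps0.
set k1 := (eps `^ p + r `^ p)^-1.
(* A majorant of the integrand: the paraboloid inside radius [r], [kappa] everywhere, [e1] up to
   distance [d] and [e2] beyond, minus the gain on the cube. *)
have jL1 := rV_integrableD jq (rV_integrableZ kappa jK).
have jL2 := rV_integrableD (rV_integrableZ e1 jr) (rV_integrableZ e2 jd).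
have jL3 := rV_integrableZ (- (G * k1)) jb.
have jL := rV_integrableD (rV_integrableD jL1 jL2) jL3.
have := rV_le_integral jw jL; rewrite -/(nonlocal_eps sigma eps w y) eqw.
rewrite !rV_integralD//; try by [exact: rV_integrableZ|exact: rV_integrableD].
rewrite !rV_integralZ// Eq Eb => H.
have {}H : f <= a * J + kappa * mass + (e1 * \int[mu]_z far_kernel sigma r z
    + e2 * \int[mu]_z far_kernel sigma d z) + - (G * k1) * l ^+ n.+1.
  apply: H => z; rewrite indicE /near_kernel_eps.
  have K0 := @kernel_eps_ge0 R n sigma eps z.
  have fr0 : 0 <= e1 * far_kernel sigma r z by rewrite mulr_ge0// far_kernel_ge0.
  have fd0 : 0 <= e2 * far_kernel sigma d z by rewrite mulr_ge0// far_kernel_ge0.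
  set W := w _ - w _; have H1z : W <= dotr c z + a * nsq z + kappa by exact: H1.
  case: (boolP (z \in _)) => [|_] /=.
    rewrite inE => /H2[zr HG]; rewrite zr mulr1.
    have k1K : k1 <= K z by apply: kernel_eps_ge => //; exact: ltW.
    have := ler_wpM2r K0 HG; have := ler_wpM2l G0 k1K; rewrite -/W; nra.
  rewrite mulr0 addr0; have [zr|rz] := ltP (enorm z) r.
    by have := ler_wpM2r K0 H1z; nra.
  rewrite mulr0 add0r; have kK : 0 <= kappa * K z by rewrite mulr_ge0.
  have [zd|dz] := ltP (enorm z) d.
    have Kr : K z <= far_kernel sigma r z by apply: kernel_eps_le_far => //; exact: ltW.
    have := ler_wpM2r K0 (H3 z zd); have := ler_wpM2l e10 Kr; rewrite -/W; lra.
  have Kd : K z <= far_kernel sigma d z by apply: kernel_eps_le_far => //; exact: ltW.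
  by have := ler_wpM2r K0 (H4 z); have := ler_wpM2l e20 Kd; rewrite -/W; lra.
have : a * J <= a * cap r by rewrite ler_wpM2l.
have : e1 * \int[mu]_z far_kernel sigma r z <= e1 * tail r by rewrite ler_wpM2l.
have : e2 * \int[mu]_z far_kernel sigma d z <= e2 * tail d by rewrite ler_wpM2l.
by lra.
Qed.

End estimates.

(** * Comparison *)

Section optimization.
Context {R : realType} {n : nat}.

Lemma almost_sup (T : Type) (t0 : T) (F : T -> R) (B kappa : R) :
  (forall t, F t <= B) -> 0 < kappa ->
  exists M t, (forall t', F t' <= M) /\ M <= F t + kappa.
Proof.
move=> FB k0; have hs : has_sup (range F).
  by split; [exists (F t0), t0|exists B => _ [t _ <-]].
exists (sup (range F)).
have [_ [t _ <-] Ft] := sup_adherent k0 hs.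
exists t; split; last by rewrite -lerBlDr ltW.
by move=> t'; apply: sup_upper_bound => //; exists t'.
Qed.

(** The points doing at least as well as [y] satisfy a|x-y|^2 <= 2U; they form a compact set, on
    which the maximum is attained. *)
Lemma penalized_argmax (u : 'rV[R]_n -> R) (U a : R) y : continuous u ->
  (forall x, `|u x| <= U) -> 0 < a ->
  exists x0, forall x, u x - a * nsq (x - y) <= u x0 - a * nsq (x0 - y).
Proof.
move=> cu uU a0; pose h x := u x - a * nsq (x - y).
have ch : continuous h.
  move=> x; have cq := @quadratic_continuous R n y 0 0 (- a).
  rewrite (_ : h = u + quadratic y 0 0 (- a)); first exact: (continuousD (cu x) (cq x)).
  apply/funext => z; rewrite /h /quadratic fctE.
  by rewrite dotrC dotr0 !add0r mulNr.
pose A := [set x | h y <= h x].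
have hy : h y = u y by rewrite /h subrr nsq0 mulr0 subr0.
have cA : compact A.
  apply: bounded_closed_compact; last first.
    rewrite (_ : A = h @^-1` [set t | h y <= t])//.
    by apply: closed_comp => [x _|]; [exact: ch|exact: closed_ge].
  (* 1 + q bounds the square root of q, for q = 2U/a. *)
  exists (`|y| + (1 + 2 * U / a)); split; first by rewrite num_real.
  move=> r rlt x /= Ax; apply: ltW; apply: le_lt_trans rlt.
  have U0 : 0 <= U := le_trans (normr_ge0 _) (uU x).
  have xy : nsq (x - y) <= 2 * U / a.
    rewrite ler_pdivlMr// mulrC; move: Ax; rewrite /A/= hy /h.
    have := uU x; have := uU y; rewrite !ler_norml => /andP[? ?] /andP[? ?]; lra.
  rewrite -[x](subrK y) addrC (le_trans (ler_normD _ _))// lerD2l.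
  rewrite (le_trans (norm_le_enorm _))//.
  have q0 : 0 <= 2 * U / a by rewrite divr_ge0 ?mulr_ge0// ltW.
  rewrite enorm_leE ?addr_ge0// (le_trans xy)//.
  by rewrite sqrrD expr1n; have := sqr_ge0 (2 * U / a); lra.
have [x0 _ x0P] := EVT_max_rV (ex_intro _ y (lexx _)) cA (continuous_subspaceT ch).
exists x0 => x; rewrite -/(h x) -/(h x0).
have [xA|/ltW xA] := leP (h y) (h x); first by apply: x0P; rewrite inE.
by apply: le_trans xA _; apply: x0P; rewrite inE /A /=.
Qed.

End optimization.

Section doubling.
Context {R : realType} {n : nat}.
Implicit Types (x y z c : 'rV[R]_n.+1).

Lemma dotrZl (t : R) c z : dotr (t *: c) z = t * dotr c z.
Proof. by rewrite /dotr mulr_sumr; apply: eq_bigr => i _; rewrite mxE mulrA. Qed.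

Lemma nonlocal_epsN (sigma eps B : R) (v : 'rV[R]_n.+1 -> R) x :
  0 < sigma < 1 -> 0 < eps -> measurable_fun setT v -> (forall y, `|v y| <= B) ->
  nonlocal_eps sigma eps (fun y => - v y) x = - nonlocal_eps sigma eps v x.
Proof.
move=> sigma01 eps0 mv vB; rewrite -[RHS]mulN1r -rV_integralZ.
  by apply: rV_eq_integral => z; ring.
exact: increment_integrable vB.
Qed.

(** No continuity of [v] is assumed, so the supremum in [y] need not be attained, and [kappa] makes
    up for it. In [x] the maximum is exact, so that the paraboloid touches [u], as a test function
    must. *)
Lemma doubling_of_variables (u v : 'rV[R]_n.+1 -> R) (U B a kappa : R) :
  continuous u -> (forall x, `|u x| <= U) -> (forall y, `|v y| <= B) ->
  0 < a -> 0 < kappa ->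
  exists M x0 y0 c, [/\ forall x, u x - v x <= M, M <= u x0 - v y0 + kappa,
    a * nsq (x0 - y0) <= 2 * U &
    forall z, [/\ u (x0 + z) - u x0 <= dotr c z + a * nsq z,
      dotr c z - a * nsq z - kappa <= v (y0 + z) - v y0 &
      u (x0 + z) - u x0 <= v (y0 + z) - v y0 + kappa]].
Proof.
move=> cu uU vB a0 kappa0.
pose Phi (q : 'rV[R]_n.+1 * 'rV[R]_n.+1) := u q.1 - v q.2 - a * nsq (q.1 - q.2).
have an0 x : 0 <= a * nsq x by rewrite mulr_ge0 ?nsq_ge0// ltW.
have PhiB q : Phi q <= U + B.
  rewrite /Phi; have := uU q.1; have := vB q.2; have := an0 (q.1 - q.2).
  by rewrite !ler_norml => ? /andP[? ?] /andP[? ?]; lra.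
have [M [[x1 y0] [PhiM Mq]]] := almost_sup (0, 0) PhiB kappa0.
have [x0 x0P] := penalized_argmax y0 cu uU a0.
have E1 x y : u x - v y - a * nsq (x - y) <= M := PhiM (x, y).
have E2 : M <= u x0 - v y0 - a * nsq (x0 - y0) + kappa.
  by apply: le_trans Mq _; have := x0P x1; rewrite /Phi/=; lra.
(* The vector is the gradient in x of a|x-y|^2 at (x0,y0). *)
exists M, x0, y0, ((2 * a) *: (x0 - y0)); split.
- by move=> y; have := E1 y y; rewrite subrr nsq0 mulr0 subr0.
- by have := an0 (x0 - y0); lra.
- have := x0P y0; rewrite subrr nsq0 mulr0 subr0.
  have := uU x0; have := uU y0; rewrite !ler_norml => /andP[? ?] /andP[? ?].
  by lra.
move=> z; rewrite dotrZl; split.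
- by have := x0P (x0 + z); rewrite [x0 + z - y0]addrAC (nsqD (x0 - y0) z); lra.
- have := E1 x0 (y0 + z).
  by rewrite opprD addrA (nsqD (x0 - y0) (- z)) dotrN nsqN; lra.
by have := E1 (x0 + z) (y0 + z); rewrite opprD addrACA subrr addr0; lra.
Qed.

End doubling.

Section one_sided.
Context {R : realType} {n : nat}.
Variables (sigma : R) (Om : set 'rV[R]_n.+1) (f u : 'rV[R]_n.+1 -> R).
Variables (U F Rb cext : R).
Local Notation p := (n.+1%:R + 2 * sigma : R).
Local Notation mu := (lebesgue_rV n.+1 : {measure set 'rV[R]_n.+1 -> \bar R}).
Local Notation cap r := (near_const n sigma * r `^ (2 - 2 * sigma)).
Local Notation tail r := (far_const n sigma * r `^ (- (2 * sigma))).
Implicit Types (x y z : 'rV[R]_n.+1) (v : 'rV[R]_n.+1 -> R).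

Hypotheses (sigma01 : 0 < sigma < 1) (oOm : open Om)
  (bdd : forall x z, Om x -> Rb < enorm z -> ~ Om (x + z)) (Rb0 : 0 < Rb)
  (ext : exterior_cubes Om cext) (cext0 : 0 < cext)
  (cu : continuous u) (mu_ : measurable_fun setT u)
  (uU : forall x, `|u x| <= U) (U0 : 0 < U) (u0 : forall x, ~ Om x -> u x = 0)
  (ucu : forall e : R, 0 < e -> exists2 d : R, 0 < d &
    forall x y, enorm (x - y) <= d -> `|u x - u y| <= e)
  (fF : forall x, Om x -> `|f x| <= F)
  (ucf : forall e : R, 0 < e -> exists2 d : R, 0 < d &
    forall x y, Om x -> Om y -> enorm (x - y) <= d -> f x - f y <= e)
  (weaku : weak_subsolution sigma Om f u).

Let tail_gt0 (r : R) : 0 < r -> 0 < tail r.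
Proof. by move=> r0; rewrite mulr_gt0 ?powR_gt0// far_const_gt0. Qed.

(* [- v <= M - u] and the smallness of [u] near the boundary make [y0] an almost
   maximum point of [- v] in a strip of width [d1] around it. *)
Lemma boundary_case (m0 eta d1 s eps B M kappa : R) v x0 y0 :
  0 < eps <= s -> 0 < s -> 0 < eta -> 12 * eta <= m0 -> s < cext -> 4 * s <= d1 ->
  (forall x y, enorm (x - y) <= d1 -> `|u x - u y| <= eta) ->
  s ^+ 2 * (U + 2 * eta) <= 4 * eta * (d1 / 4) ^+ 2 ->
  eta * (4 * near_const n sigma * 5 `^ (2 - 2 * sigma) + 3 * far_const n sigma) <=
    m0 / 4 * (cext ^+ n.+1 / (1 + 5 `^ p)) ->
  F + 1 + (U + 2 * eta) * tail (d1 / 2) <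
    m0 / 4 * (cext ^+ n.+1 / (1 + 5 `^ p)) * s `^ (- (2 * sigma)) ->
  0 < kappa <= eta -> kappa * (\int[mu]_z kernel_eps sigma eps z) <= 1 ->
  approx_solution sigma Om f eps v -> (forall y, `|v y| <= B) ->
  m0 < M -> (forall y, u y - v y <= M) -> M - kappa <= - v y0 ->
  ~ Om x0 -> Om y0 -> enorm (x0 - y0) <= s -> False.
Proof.
move=> /andP[eps0 epss] s0 eta0 eta12 scext sd1 ud1 sU etaC sbig /andP[k0 keta]
  kmass [_ cv eqv v0] vB m0M uvM Mv nOmx0 Omy0 xy0.
have mv : measurable_fun setT v by exact: measurable_fun_open_support cv v0.
(* The perturbing paraboloid reaches [4 * eta] at distance [s]. *)
pose w y := - v y; pose A := 4 * eta / s ^+ 2.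
have s20 : 0 < s ^+ 2 by rewrite exprn_gt0.
have A0 : 0 < A by rewrite divr_gt0 ?mulr_gt0.
have As : A * s ^+ 2 = 4 * eta by rewrite divfK// gt_eqF.
have wle y : w y <= M - u y by have := uvM y; rewrite /w; lra.
have wU y : w y <= M + U.
  by have := wle y; have := uU y; rewrite ler_norml => /andP[? ?]; lra.
have Psi_le y : w y - A * nsq (y - y0) <= M + U.
  by rewrite (le_trans _ (wU y))// gerBl mulr_ge0 ?nsq_ge0// ltW.
have [S [y1 [SP Sy1]]] := almost_sup y0 Psi_le k0.
have Psi1 y : w y - A * nsq (y - y0) <= w y1 - A * nsq (y1 - y0) + kappa.
  exact: le_trans (SP y) Sy1.
have AN1 : 0 <= A * nsq (y1 - y0) by rewrite mulr_ge0 ?nsq_ge0// ltW.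
have wy1 : M - 2 * eta + A * nsq (y1 - y0) <= w y1.
  have := Psi1 y0; rewrite subrr nsq0 mulr0 subr0 /w in AN1 *; lra.
have Omy1 : Om y1.
  apply: contrapT => /v0 vy1; move: wy1; rewrite /w vy1; lra.
(* [y1] is located in two stages: the global bound M + U puts it within [d1 / 4] of [y0], hence
   within [d1] of [x0]; there the bound M + eta improves the distance to [s]. *)
have near1 : enorm (y1 - y0) <= d1 / 4.
  rewrite enorm_leE; last by lra.
  rewrite -(ler_pM2l (_ : 0 < 4 * eta)) ?mulr_gt0//.
  apply: le_trans sU; rewrite -As mulrAC mulrC ler_wpM2l ?(ltW s20)//.
  by have := wU y1; lra.
have xy1 : enorm (x0 - y1) <= d1.
  rewrite (_ : x0 - y1 = (x0 - y0) + (y0 - y1)); last by rewrite addrA subrK.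
  rewrite (le_trans (enormD_le (r := d1 / 4) _ _))//; first by lra.
  - by rewrite enormB.
  - by lra.
have w_near y : enorm (x0 - y) <= d1 -> w y <= M + eta.
  move=> /ud1; rewrite u0// sub0r normrN => uy; have := wle y.
  by move: uy; rewrite ler_norml => /andP[? ?]; lra.
have near2 : enorm (y1 - y0) <= s.
  rewrite enorm_leE; last exact: ltW.
  rewrite -(ler_pM2l A0) As; have := w_near _ xy1; lra.
have xy1s : enorm (x0 - y1) <= 2 * s.
  rewrite (_ : x0 - y1 = (x0 - y0) + (y0 - y1)); last by rewrite addrA subrK.
  by apply: enormD_le => //; rewrite enormB.
have [E EP] : exists a : 'I_n.+1 -> R,
    forall z, (forall i, a i < z ord0 i <= a i + cext * s) ->
      ~ Om (x0 + z) /\ enorm z <= s.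
  apply: (ext nOmx0 Omy0); last by rewrite s0.
  by rewrite (le_lt_trans (norm_le_enorm _))// (le_lt_trans xy0).
(* The exterior cube seen from [x0], with its displacements now measured from [y1]. *)
pose E1 i := E i + (x0 - y1) ord0 i.
pose c := (2 * A) *: (y1 - y0).
have quadE z : dotr c z + A * nsq z = A * (nsq (y1 + z - y0) - nsq (y1 - y0)).
  rewrite (_ : y1 + z - y0 = (y1 - y0) + z); last by rewrite addrAC.
  by rewrite nsqD /c dotrZl; ring.
have mw : measurable_fun setT w by exact: measurable_funN.
have wB y : `|w y| <= B by rewrite normrN.
have eqw : nonlocal_eps sigma eps w y1 = f y1.
  by rewrite -(eqv _ Omy1) -(nonlocal_epsN y1 sigma01 eps0 mv vB).
have d10 : 0 < d1 by lra.
have s5 : 0 < 5 * s by rewrite mulr_gt0.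
(* Displacements of the cube have length at most 4s, whence the radius [5 * s]; [3 * eta] and
   [U + 2 * eta] bound the increases of [w] in the strip and everywhere. *)
have := @boundary_estimate R n sigma eps sigma01 eps0 w (f y1) B y1 E1 (cext * s) c
  A kappa (m0 / 2) (5 * s) (d1 / 2) (3 * eta) (U + 2 * eta) mw wB eqw.
have m00 : 0 < m0 by lra.
have H1 z : w (y1 + z) - w y1 <= dotr c z + A * nsq z + kappa.
  by rewrite quadE; have := Psi1 (y1 + z); lra.
have H2 z : (forall i, E1 i < z ord0 i <= E1 i + cext * s) -> enorm z < 5 * s /\
    w (y1 + z) - w y1 <= dotr c z + A * nsq z + kappa - m0 / 2.
  move=> zE; have [|nOm zs] := EP (z - (x0 - y1)).
    move=> i; have := zE i; rewrite /E1 !mxE => /andP[? ?].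
    by apply/andP; split; lra.
  split.
    rewrite -[z](subrK (x0 - y1)) (le_lt_trans (enormD_le (r := 2 * s) _ _))//;
    lra.
  have -> : w (y1 + z) = 0.
    rewrite /w v0 ?oppr0// => Omz; apply: nOm; move: Omz; congr Om.
    by rewrite opprB addrCA; apply/rowP => i; rewrite !mxE; ring.
  (* On the cube [w] is 0, while [w y1] is at least M - 2 eta and the paraboloid drops by at most 4
     eta; as 12 eta <= m0 < M, half of [m0] remains. *)
  rewrite quadE; have : A * nsq (y1 - y0) <= 4 * eta.
    by rewrite -As ler_wpM2l ?(ltW A0)// -enorm_leE// ltW.
  have : 0 <= A * nsq (y1 + z - y0) by rewrite mulr_ge0 ?nsq_ge0// ltW.
  lra.
have H3 z : enorm z < d1 / 2 -> w (y1 + z) - w y1 <= 3 * eta.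
  move=> zd; have : w (y1 + z) <= M + eta.
    apply: w_near; rewrite opprD addrA.
    rewrite (le_trans (enormD_le (r := d1 / 2) _ _))//; last by lra.
    - by rewrite (le_trans xy1s)//; lra.
    - by rewrite enormN ltW.
  lra.
have H4 z : w (y1 + z) - w y1 <= U + 2 * eta by have := wU (y1 + z); lra.
have cs0 : 0 <= cext * s by rewrite mulr_ge0// ltW.
have d20 : 0 < d1 / 2 by rewrite divr_gt0.
have e10 : 0 <= 3 * eta by rewrite mulr_ge0// ltW.
have e20 : 0 <= U + 2 * eta by rewrite addr_ge0 ?mulr_ge0// ltW.
have m20 : 0 <= m0 / 2 by rewrite divr_ge0// ltW.
move=> /(_ cs0 (ltW A0) (ltW k0) m20 s5 d20 e10 e20 H1 H2 H3 H4).
set X := s `^ (- (2 * sigma)) in sbig.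
have X0 : 0 < X by exact: powR_gt0.
have -> : A * cap (5 * s) = 4 * eta * near_const n sigma * 5 `^ (2 - 2 * sigma) * X.
  rewrite powRM ?(ltW s0)// (_ : s `^ (2 - 2 * sigma) = s ^+ 2 * X); last first.
    rewrite -powR_mulrn ?(ltW s0)// -powRD//.
    by apply/implyP => _; rewrite gt_eqF.
  transitivity (A * s ^+ 2 * near_const n sigma * 5 `^ (2 - 2 * sigma) * X); first by ring.
  by rewrite As.
have tail5 : tail (5 * s) <= far_const n sigma * X.
  apply: ler_wpM2l; first exact/ltW/far_const_gt0.
  rewrite powRM ?(ltW s0)// -[leRHS]mul1r ler_wpM2r ?(ltW X0)// powRN.
  rewrite invf_le1 ?powR_gt0//; have /andP[sg0 _] := sigma01.
  have := @ler_powR R 5 _ 0 (2 * sigma); rewrite powRr0; apply; first by rewrite ler1n.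
  by rewrite mulr_ge0// ltW.
(* Here [eps <= s] enters: eps^p + (5s)^p <= (1 + 5^p) s^p. *)
have kcX : cext ^+ n.+1 / (1 + 5 `^ p) * X <= (eps `^ p + (5 * s) `^ p)^-1 * (cext * s) ^+ n.+1.
  rewrite mulrAC -powR_scale// mulrAC ler_wpM2r ?exprn_ge0// -invfM.
  rewrite lef_pV2 ?posrE ?mulr_gt0 ?powR_gt0 ?ltr_pwDl ?powR_gt0 ?powR_ge0//.
  rewrite mulrDr mulr1 powRM ?(ltW s0)// [5 `^ p * _]mulrC lerD2r.
  by rewrite ge0_ler_powR ?nnegrE ?(ltW eps0) ?(ltW s0)// ltW// kernel_exponent_gt0.
have fy1 : - F <= f y1 by have := fF Omy1; rewrite ler_norml => /andP[].
(* One half of the gain absorbs the losses proportional to [eta], by [etaC]; the other half exceeds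
   the bounded terms, by [sbig], contradicting f y1 >= -F. *)
have := ler_wpM2l m20 kcX; have := ler_wpM2l e10 tail5.
have := ler_wpM2r (ltW X0) etaC.
move: sbig fy1 kmass; set kc := cext ^+ _ / _; set T2 := tail (d1 / 2).
set T5 := tail (5 * s); set Q := _^-1 * _ ^+ _; rewrite -[m0 / 2 * _^-1 * _]mulrA -/Q.
nra.
Qed.

Lemma powR_small (t e : R) : 0 < t -> 0 < e ->
  exists2 d : R, 0 < d & forall x : R, 0 < x <= d -> x `^ t < e.
Proof.
move=> t0 e0; have /cvgr0Pnorm_lt/(_ e e0) := @powR_cvg0 R t t0.
move=> [d /= d0 dP]; exists (d / 2); first by rewrite divr_gt0.
move=> x /andP[x0 xd]; have := dP x; rewrite /= sub0r normrN gtr0_norm// => H.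
by rewrite (le_lt_trans (ler_norm _))// H//; lra.
Qed.

Lemma powR_large (t W C : R) : 0 < t -> 0 < W ->
  exists2 d : R, 0 < d & forall x : R, 0 < x <= d -> C < W * x `^ (- t).
Proof.
move=> t0 W0; have C0 : 0 < `|C| + 1 by rewrite ltr_wpDl.
have [d d0 dP] := powR_small t0 (divr_gt0 W0 C0).
exists d => // x xd; have /andP[x0 _] := xd.
rewrite powRN ltr_pdivlMr ?powR_gt0//; have := dP x xd.
rewrite ltr_pdivlMr// => H; apply: le_lt_trans H; rewrite mulrC.
rewrite ler_wpM2l ?powR_ge0//.
by rewrite (le_trans (ler_norm C))// lerDl.
Qed.

(** The parameters are chosen in the order [eta], [d1], [s], [a], [r], then the threshold for eps,
    and lastly [kappa], which depends on the mass of the kernel. The threshold is fixed before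
    [v]. *)
Lemma one_sided_estimate (m0 : R) : 0 < m0 -> exists2 e0 : R, 0 < e0 &
  forall eps v, 0 < eps < e0 -> approx_solution sigma Om f eps v ->
  forall x, u x - v x <= m0.
Proof.
move=> m00; have /andP[sg0 sg1] := sigma01.
have p0 : 0 < p := kernel_exponent_gt0 sigma01.
have Cn0 : 0 < near_const n sigma by exact: near_const_gt0.
have C0 : 0 < far_const n sigma by exact: far_const_gt0.
pose k0 := @box_weight R n sigma Rb.
have k00 : 0 < k0 by exact: box_weight_gt0.
pose kc := cext ^+ n.+1 / (1 + 5 `^ p).
have kc0 : 0 < kc by rewrite divr_gt0 ?exprn_gt0// ltr_pwDl ?powR_ge0.
pose D := 4 * near_const n sigma * 5 `^ (2 - 2 * sigma) + 3 * far_const n sigma.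
have D0 : 0 < D.
  have q0 : 0 < 5 `^ (2 - 2 * sigma) :> R by exact: powR_gt0.
  by apply: addr_gt0; do ![apply: mulr_gt0 => //].
have W0 : 0 < m0 / 4 * kc by rewrite mulr_gt0// divr_gt0.
pose eta := Num.min (m0 / 12) (m0 / 4 * kc / D).
have eta0 : 0 < eta by rewrite lt_min !divr_gt0.
have eta12 : 12 * eta <= m0.
  by rewrite mulrC -ler_pdivlMr// ge_min lexx.
have etaD : eta * D <= m0 / 4 * kc.
  by rewrite -ler_pdivlMr// ge_min lexx orbT.
have [d1 d10 ud1] := ucu eta0.
have [df df0 fdf] := ucf (mulr_gt0 (divr_gt0 m00 (ltr0Sn _ 3)) k00).
have [db db0 sbig] := @powR_large (2 * sigma) (m0 / 4 * kc)
  (F + 1 + (U + 2 * eta) * tail (d1 / 2)) (mulr_gt0 (ltr0Sn _ 1) sg0) W0.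
have Ueta : 0 < U + 2 * eta by rewrite addr_gt0 ?mulr_gt0.
(* As t^2 <= t for t <= 1, bounding [s] by [d1 / 4 * t] yields [sU] without a square root. *)
pose t := Num.min 1 (4 * eta / (U + 2 * eta)).
have t0 : 0 < t by rewrite lt_min ltr01 divr_gt0 ?mulr_gt0.
have t1 : t <= 1 by rewrite ge_min lexx.
have tU : t * (U + 2 * eta) <= 4 * eta.
  by rewrite -ler_pdivlMr// ge_min lexx orbT.
pose s := Num.min (Num.min (cext / 2) (d1 / 4 * t)) (Num.min df db).
have c20 : 0 < cext / 2 by exact: divr_gt0.
have d14 : 0 < d1 / 4 by exact: divr_gt0.
have s0 : 0 < s by rewrite !lt_min c20 df0 db0 mulr_gt0.
have s_cext : s <= cext / 2 by rewrite !ge_min lexx.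
have s_d1t : s <= d1 / 4 * t by rewrite !ge_min lexx !orbT.
have s_df : s <= df by rewrite !ge_min lexx !orbT.
have s_db : s <= db by rewrite !ge_min lexx !orbT.
have s_d1 : s <= d1 / 4.
  by apply: le_trans s_d1t _; rewrite -[leRHS]mulr1 ler_wpM2l// divr_ge0// ltW.
have scext : s < cext by lra.
have sd1 : 4 * s <= d1 by lra.
have sU : s ^+ 2 * (U + 2 * eta) <= 4 * eta * (d1 / 4) ^+ 2.
  apply: (@le_trans _ _ ((d1 / 4) ^+ 2 * (t * (U + 2 * eta)))); last first.
    by rewrite mulrC ler_wpM2r// sqr_ge0.
  rewrite mulrA ler_wpM2r ?(ltW Ueta)//.
  apply: (@le_trans _ _ ((d1 / 4 * t) ^+ 2)).
    by rewrite ler_sqr ?nnegrE ?(ltW s0)// mulr_ge0 ?divr_ge0 ?(ltW d10) ?(ltW t0).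
  rewrite exprMn ler_wpM2l ?sqr_ge0// expr2 -[leRHS]mul1r ler_wpM2r// ltW//.
(* The doubling gives a|x0-y0|^2 <= 2U, so this [a] forces |x0-y0| <= s. *)
pose a := 2 * U / s ^+ 2.
have s20 : 0 < s ^+ 2 by rewrite exprn_gt0.
have a0 : 0 < a by rewrite divr_gt0 ?mulr_gt0.
have as2 : a * s ^+ 2 = 2 * U by rewrite divfK// gt_eqF.
have e20 : 0 < 2 - 2 * sigma by lra.
have mk0 : 0 < m0 * k0 / 8 by apply: divr_gt0 => //; exact: mulr_gt0.
have aC0 : 0 < 3 * (a * near_const n sigma) by do ![apply: mulr_gt0 => //].
(* [r], and then eps, make the paraboloid error and the kernel error at most [m0 * k0 / 8] each. *)
have [dr dr0 drP] := powR_small e20 (divr_gt0 mk0 aC0).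
pose r := Num.min dr Rb.
have r0 : 0 < r by rewrite lt_min dr0.
have rRb : r <= Rb by rewrite ge_min lexx orbT.
have capr : 3 * (a * cap r) <= m0 * k0 / 8.
  have := drP r; rewrite r0 ge_min lexx => /(_ isT).
  rewrite ltr_pdivlMr// => /ltW; apply: le_trans.
  by rewrite le_eqVlt; apply/orP; left; apply/eqP; ring.
have Utail : 0 < 2 * U * tail r by apply: mulr_gt0; [exact: mulr_gt0|exact: tail_gt0].
have [de de0 deP] := powR_small p0 (divr_gt0 mk0 Utail).
exists (Num.min (Num.min 1 s) (de * r)).
  by rewrite lt_min (mulr_gt0 de0 r0) andbT lt_min ltr01; exact: s0.
move=> eps v /andP[eps0]; rewrite lt_min => /andP[+ epsr] av x.
rewrite lt_min => /andP[eps1 epss].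
have := av; case=> bv cv eqv v0.
rewrite leNgt; apply/negP => xm0.
have [B vB] : exists B, forall y, `|v y| <= B.
  have [B [_ BP]] := bv; exists (B + 1) => y.
  by apply: (BP (B + 1)); rewrite ?ltrDl.
have mv : measurable_fun setT v by exact: measurable_fun_open_support cv v0.
pose mass := \int[mu]_z kernel_eps sigma eps z.
have mass0 : 0 <= mass by apply: Rintegral_ge0 => z _; exact: kernel_eps_ge0.
have mass1 : 0 < mass + 1 by rewrite ltr_wpDl.
pose kappa := Num.min eta (Num.min 1 (m0 * k0 / 8) / (mass + 1)).
have kappa0 : 0 < kappa by rewrite lt_min eta0 divr_gt0// lt_min ltr01.
have kappa_eta : kappa <= eta by rewrite ge_min lexx.
have kmass : kappa * mass <= Num.min 1 (m0 * k0 / 8).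
  apply: (@le_trans _ _ (kappa * (mass + 1))).
    by rewrite ler_wpM2l ?(ltW kappa0)// lerDl.
  by rewrite -ler_pdivlMr// ge_min lexx orbT.
have kmass1 : kappa * mass <= 1 by rewrite (le_trans kmass)// ge_min lexx.
have kmass2 : kappa * mass <= m0 * k0 / 8.
  by rewrite (le_trans kmass)// ge_min lexx orbT.
have [M [x0 [y0 [c [uvM H4 axy H]]]]] := doubling_of_variables cu uU vB a0 kappa0.
have m0M : m0 < M := lt_le_trans xm0 (uvM x).
have xy0 : enorm (x0 - y0) <= s.
  by rewrite enorm_leE ?(ltW s0)// -(ler_pM2l a0) as2.
have uxy : `|u x0 - u y0| <= eta.
  by apply: ud1; rewrite (le_trans xy0)// (le_trans _ sd1)// ler_peMl ?(ltW s0)// ler1n.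
have [Omy0|nOmy0] := pselect (Om y0); last first.
  (* Both functions vanish at [y0], so M <= u x0 + kappa <= 2 eta, against 12 eta <= m0 < M. *)
  have := v0 _ nOmy0; have := u0 nOmy0; move: uxy.
  rewrite ler_norml => /andP[_ +] uy0 vy0; rewrite uy0 => ?.
  by move: H4; rewrite vy0; lra.
have [Omx0|nOmx0] := pselect (Om x0); last first.
  apply: (@boundary_case m0 eta d1 s eps B M kappa v x0 y0) => //.
  - by rewrite eps0 ltW.
  - by apply: sbig; rewrite s0.
  - by rewrite kappa0.
  - by move: H4; rewrite (u0 nOmx0) add0r lerBlDr.
have H1 z : u (x0 + z) - u x0 <= dotr c z + a * nsq z by have [] := H z.
have H2 z : dotr c z - a * nsq z - kappa <= v (y0 + z) - v y0 by have [] := H z.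
have H3 z : u (x0 + z) - u x0 <= v (y0 + z) - v y0 + kappa by have [] := H z.
have eqy : nonlocal_eps sigma eps v y0 = - f y0 by rewrite -(eqv _ Omy0) opprK.
have M0 : 0 <= M := ltW (lt_trans m00 m0M).
have epsr' : (eps / r) `^ p < m0 * k0 / 8 / (2 * U * tail r).
  by apply: deP; rewrite divr_gt0//= ler_pdivrMr// ltW.
have := interior_estimate sigma01 eps0 mu_ uU mv vB u0 v0 bdd weaku eqy
  (ltW eps1) (ltW a0) (ltW kappa0) M0 r0 rRb Omx0 Omy0 H1 H2 H3 H4.
have : f x0 - f y0 <= m0 / 4 * k0 by apply: fdf => //; exact: le_trans s_df.
move: epsr'; rewrite ltr_pdivlMr// => epsr'.
(* The right-hand side of the interior estimate is at most (1/4 + 3/8) m0 k0, less than M k0 on the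
   left. *)
have : m0 * k0 < M * k0 by rewrite ltr_pM2r.
rewrite -/k0 -/mass; move: epsr'; set P := (eps / r) `^ p; set T := tail r; lra.
Qed.

End one_sided.

(** * The opposite problem and the convergence *)

Section opposite_problem.
Context {R : realType} {n : nat}.
Variables (sigma : R) (Om : set 'rV[R]_n.+1).
Hypotheses (sigma01 : 0 < sigma < 1) (oOm : open Om).

Lemma approx_solutionN (f v : 'rV[R]_n.+1 -> R) eps : 0 < eps ->
  approx_solution sigma Om f eps v ->
  approx_solution sigma Om (\- f) eps (\- v).
Proof.
move=> eps0 [bv cv eqv v0].
have [B vB] : exists B, forall y, `|v y| <= B.
  have [B [_ BP]] := bv; exists (B + 1) => y.
  by apply: (BP (B + 1)); rewrite ?ltrDl.
have mv : measurable_fun setT v by exact: measurable_fun_open_support cv v0.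
split.
- have [M [Mr MP]] := bv; exists M; split=> // r Mlt y _ /=.
  by rewrite normrN; exact: MP.
- by move=> x Omx; apply: continuousN; exact: cv.
- by move=> x Omx; rewrite /= (nonlocal_epsN x sigma01 eps0 mv vB) eqv.
- by move=> x nOmx /=; rewrite v0 ?oppr0.
Qed.

End opposite_problem.

Lemma cvg_ereal0 (R : realType) (T : Type) (G : set_system T) (FG : Filter G)
    (g : T -> \bar R) :
  (forall t, (0 <= g t)%E) ->
  (forall e : R, 0 < e -> \forall t \near G, (g t <= e%:E)%E) ->
  g t @[t --> G] --> 0%E.
Proof.
move=> g0 gle A; rewrite /nbhs/= => /nbhs_ballP[e /= e0 eA].
have e20 : 0 < e / 2 by rewrite divr_gt0.
have := gle _ e20; apply: filterS => t gt; rewrite /=.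
have := g0 t; case: (g t) gt => [r| |]//; rewrite !lee_fin => re r0.
apply: (eA r); rewrite -ball_normE/= sub0r normrN ger0_norm//.
by rewrite (le_lt_trans re)// gtr_pMr// invf_lt1// ltr1n.
Qed.

Lemma Linfty_norm_le (R : realType) n (A : set 'rV[R]_n) (g : 'rV[R]_n -> R) (c : R) :
  0 <= c -> (forall x, A x -> `|g x| <= c) -> (Linfty_norm A g <= c%:E)%E.
Proof.
move=> c0 gc; rewrite /Linfty_norm unlock; case: ifP => _; last by rewrite lee_fin.
apply/ess_supP; apply: nearW => x /=; rewrite lee_fin patchE.
by case: ifPn => [/set_mem/gc//|_]; rewrite normr0.
Qed.

Theorem corollary1p2 (R : realType) (n : nat) (sigma : R)
    (Om : set 'rV[R]_n.+1) (f : 'rV[R]_n.+1 -> R)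
    (ueps : R -> 'rV[R]_n.+1 -> R) (u : 'rV[R]_n.+1 -> R) :
  0 < sigma < 1 ->
  bounded_C2_domain Om ->
  {within closure Om, continuous f} ->
  (forall eps, 0 < eps < 1 -> approx_solution sigma Om f eps (ueps eps)) ->
  visc_solution sigma Om f u ->
  Linfty_norm (closure Om) (fun x => ueps eps x - u x) @[eps --> 0^'+] --> 0%E.
Proof.
move=> sigma01 [oOm _ Om0 bOm C2Om] cf ueps_sol [cuw usub usup u0].
have cK : compact (closure Om) := compact_closure_bounded bOm.
have K0 : closure Om !=set0 by have [x Omx] := Om0; exists x; exact: subset_closure.
have [c c0 ext] := exterior_cubes_C2 oOm bOm C2Om.
have [U1 uU1] := within_continuous_bounded cK K0 cuw.
have [F fF1] := within_continuous_bounded cK K0 cf.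
have fF x : Om x -> `|f x| <= F by move=> Omx; apply: fF1; exact: subset_closure.
pose U := `|U1| + 1.
have U0 : 0 < U by rewrite ltr_wpDl.
have uU x : `|u x| <= U.
  have [clx|nclx] := pselect (closure Om x).
    by rewrite (le_trans (uU1 x clx))// (le_trans (ler_norm _))// lerDl.
  by rewrite u0 ?normr0 ?(ltW U0)// => Omx; apply: nclx; exact: subset_closure.
have uloc := zero_extension_continuous oOm cuw u0.
have cu : continuous u.
  move=> x; apply: (iffRL (@cvgrPdist_lt _ _ _ (nbhs (x : 'rV[R]_n.+1)) _ u (u x))).
  move=> e /(uloc x)[d d0 dP].
  by apply/nbhs_ballP; exists d => //= y; rewrite -ball_normE; exact: dP.
have mu_ : measurable_fun setT u by exact: continuous_measurable_fun_rV.
have ucu (e : R) : 0 < e -> exists2 d : R, 0 < d &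
    forall x y, enorm (x - y) <= d -> `|u x - u y| <= e.
  have uloc' x : closure Om x -> forall r : R, 0 < r -> exists2 d : R, 0 < d &
      forall y, [set: 'rV[R]_n.+1] y -> `|x - y| < d -> `|u x - u y| < r.
    by move=> _ r r0; have [d d0 dP] := uloc x r r0; exists d => // y _; exact: dP.
  move=> e0; have [d d0 dP] := compact_uniformly_continuous cK uloc' (@subsetT _ _) e0.
  have near_cl x y : closure Om x -> enorm (x - y) <= d / 2 -> `|u x - u y| <= e.
    move=> clx xy; apply: ltW; apply: dP => //.
    by rewrite (le_lt_trans (norm_le_enorm _))// (le_lt_trans xy)// gtr_pMr// invf_lt1// ltr1n.
  exists (d / 2) => [|x y xy]; first by rewrite divr_gt0.
  have [clx|nclx] := pselect (closure Om x); first exact: near_cl.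
  have [cly|ncly] := pselect (closure Om y).
    by rewrite distrC; apply: near_cl => //; rewrite enormB.
  rewrite !u0 ?subrr ?normr0 ?ltW// => Omz; [apply: ncly|apply: nclx];
  exact: subset_closure.
have ucf (e : R) : 0 < e -> exists2 d : R, 0 < d &
    forall x y, Om x -> Om y -> enorm (x - y) <= d -> `|f x - f y| <= e.
  move=> e0; have [d d0 dP] :=
    compact_uniformly_continuous cK (within_continuousE cf) (@subset_refl _ _) e0.
  exists (d / 2) => [|x y Omx Omy xy]; first by rewrite divr_gt0.
  apply: ltW; apply: dP; [exact: subset_closure|exact: subset_closure|].
  by rewrite (le_lt_trans (norm_le_enorm _))// (le_lt_trans xy)// gtr_pMr// invf_lt1// ltr1n.
have [Rb Rb0 bdd] : exists2 Rb : R, 0 < Rb &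
    forall x z, Om x -> Rb < enorm z -> ~ Om (x + z).
  have [M [_ MP]] := bOm; pose M1 := `|M| + 1.
  have M10 : 0 < M1 by rewrite ltr_wpDl.
  have OmM x : Om x -> `|x| <= M1.
    by apply: MP; rewrite (le_lt_trans (ler_norm _))// ltrDl.
  (* The factor N turns the sup-norm bound on the diameter into a Euclidean one. *)
  exists (n.+1%:R * (M1 + M1)); first by rewrite mulr_gt0// addr_gt0.
  move=> x z Omx zlt Omxz; have := lt_le_trans zlt (enorm_le_norm z).
  rewrite ltr_pM2l// ltNge => /negP; apply.
  rewrite (_ : z = (x + z) - x); last by rewrite addrC addKr.
  by rewrite (le_trans (ler_normB _ _))// lerD// OmM.
have weaku := visc_subsolution_weak sigma01 oOm mu_ uU usub.
have weakNu := visc_supersolution_weak sigma01 oOm mu_ uU usup.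
have upper (m : R) : 0 < m -> exists2 e0 : R, 0 < e0 &
    forall eps v, 0 < eps < e0 -> approx_solution sigma Om f eps v ->
    forall x, u x - v x <= m.
  apply: (one_sided_estimate sigma01 oOm bdd Rb0 ext c0 cu mu_ uU U0 u0 ucu fF _ weaku).
  move=> e e0; have [d d0 dP] := ucf e e0; exists d => // x y Omx Omy xy.
  by rewrite (le_trans (ler_norm _))// dP.
(* The problem is odd: with -u and -f, and -u_eps in the role of [v], the same estimate bounds u_eps
   - u. *)
have lower (m : R) : 0 < m -> exists2 e0 : R, 0 < e0 &
    forall eps v, 0 < eps < e0 -> approx_solution sigma Om (\- f) eps v ->
    forall x, (\- u) x - v x <= m.
  apply: (one_sided_estimate (U := U) (F := F) sigma01 oOm bdd Rb0 ext c0 _ _ _ U0 _ _ _ _ weakNu).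
  - by move=> x; apply: continuousN; exact: cu.
  - exact: measurable_funN.
  - by move=> x /=; rewrite normrN.
  - by move=> x nOmx /=; rewrite u0 ?oppr0.
  - move=> e e0; have [d d0 dP] := ucu e e0; exists d => // x y xy /=.
    by rewrite -opprD normrN; exact: dP.
  - by move=> x Omx /=; rewrite normrN; exact: fF.
  move=> e e0; have [d d0 dP] := ucf e e0; exists d => // x y Omx Omy xy /=.
  by rewrite (le_trans (ler_norm _))// -opprD normrN dP.
apply: cvg_ereal0 => [eps|e e0]; first exact: Lnorm_ge0.
have [e1 e10 up] := upper e e0; have [e2 e20 lo] := lower e e0.
near=> eps.
have eps0 : 0 < eps by near: eps; exact: nbhs_right_gt.
have eps1 : eps < 1 by near: eps; exact: nbhs_right_lt.
have epse1 : eps < e1 by near: eps; exact: nbhs_right_lt.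
have epse2 : eps < e2 by near: eps; exact: nbhs_right_lt.
have sol : approx_solution sigma Om f eps (ueps eps) by apply: ueps_sol; rewrite eps0.
have solN := approx_solutionN sigma01 oOm eps0 sol.
apply: Linfty_norm_le => [|x _]; first exact: ltW.
have ux : u x - ueps eps x <= e by apply: (up eps) => //; rewrite eps0.
have lx : (\- u) x - (\- ueps eps) x <= e by apply: (lo eps) => //; rewrite eps0.
move: lx => /= lx.
by rewrite ler_norml; apply/andP; split; lra.
Unshelve. all: by end_near. Qed.
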